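(* Let $\mathscr{H}$ be a complex Hilbert space, $d\ge1$, and let $\mathbf{A}=(A_1,\ldots,A_d)\in\mathbb{B}^d(\mathscr{H})$. Then $$w_e(\mathbf{A})\le\sqrt{\frac14\left\|\sum_{k=1}^d\left(|A_k^*|^{4(1-t)}+|A_k|^{4t}\right)\right\|+\frac{\sqrt d}{2}w_e\left(|\mathbf{A}|^{2t}|\mathbf{A}^*|^{2(1-t)}\right)}$$ for all $t$, $0\le t\le1$. In particular, $$w_e(\mathbf{A})\le\sqrt{\frac14\left\|\sum_{k=1}^d\left(|A_k^*|^{2}+|A_k|^{2}\right)\right\|+\frac{\sqrt d}{2}w_e\left(|\mathbf{A}||\mathbf{A}^*|\right)}.$$
   Context: $\mathbb{B}(\mathscr{H})$ is the algebra of bounded linear operators on the complex Hilbert space $\mathscr{H}$, and $\mathbb{B}^d(\mathscr{H})$ is the set of $d$-tuples of such operators. For $T\in\mathbb{B}(\mathscr{H})$, $|T|=(T^*T)^{1/2}$, $|T|^0=I$ (identity operator), and $\|T\|$ is the operator norm. For $\mathbf{T}=(T_1,\ldots,T_d)$, the Euclidean operator radius is $w_e(\mathbf{T})=\sup\{(\sum_{k=1}^d|\langle T_kx,x\rangle|^2)^{1/2}:\|x\|=1\}$. Operations on tuples are componentwise: $|\mathbf{A}|^s=(|A_1|^s,\ldots,|A_d|^s)$, $|\mathbf{A}^*|^s=(|A_1^*|^s,\ldots,|A_d^*|^s)$, and products are componentwise. *)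

(* Defs.v *)
From HB Require Import structures.
From mathcomp Require Import all_boot all_order all_algebra sesquilinear.
From mathcomp Require Import complex.
From mathcomp Require Import all_classical all_reals all_analysis.

Set Implicit Arguments.
Unset Strict Implicit.
Unset Printing Implicit Defensive.

Import Order.TTheory GRing.Theory Num.Theory.
Import numFieldNormedType.Exports.

Local Open Scope classical_set_scope.
Local Open Scope ring_scope.
Local Open Scope complex_scope.

(* Norms take values in R[i] (and are real there), and the inner product is
   linear in its first argument and conjugate-linear in its second one. *)
HB.mixin Record CompleteNormedModule_isHilbert (R : realType) H
    & CompleteNormedModule R[i] H := {
  hdot : {dot H for Num.conj} ;
  hdot_norm : forall x : H, hdot x x = `|x| ^+ 2
}.

#[short(type="hilbertType")]
HB.structure Definition Hilbert (R : realType) :=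
  {H of CompleteNormedModule R[i] H & CompleteNormedModule_isHilbert R H}.

Section Operators.
Context {R : realType} {H : hilbertType R}.
Implicit Types (T P : H -> H) (f : R -> R).

(* For linear T this is the existence of a bound `|T x| <= M * `|x|, see
   linear_boundedP. *)
Definition bounded_op T : Prop := bounded_near T (nbhs (0 : H)).

Definition opnorm T : R := sup [set complex.Re `|T x| | x in [set x : H | `|x| <= 1]].

(* On the zero space the set below is empty, and its sup is then 0. *)
Definition euclidean_radius d (T : 'I_d -> H -> H) : R :=
  sup [set Num.sqrt (\sum_(k < d) (complex.Re `|hdot (T k x) x|) ^+ 2)
      | x in [set x : H | `|x| = 1]].

(* Riesz' theorem provides exactly one such S when T is linear and bounded. *)
Definition adjoint T : {linear H -> H} :=
  get [set S : {linear H -> H} | bounded_op S /\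
        forall x y : H, hdot (T x) y = hdot x (S y)].

Definition poly_op (p : {poly R}) T (x : H) : H :=
  \sum_(i < size p) (p`_i)%:C *: iter i T x.

(* Q = f(P) in the continuous functional calculus of a positive bounded operator
   P: it is the norm limit of p_n(P), where the real polynomials p_n converge to
   f uniformly on [0, ||P||], an interval that contains the spectrum of P. *)
Definition is_fun_calc f P (Q : H -> H) : Prop :=
  exists p : nat -> {poly R},
    (forall e : R, 0 < e -> \forall n \near \oo,
       forall u : R, 0 <= u <= opnorm P -> `|(p n).[u] - f u| <= e) /\
    (fun n => opnorm (fun x => poly_op (p n) P x - Q x)) @ \oo --> (0 : R).

(* There is exactly one such Q when P is positive, linear and bounded, and f is
   continuous on [0, ||P||]. *)
Definition fun_calc f P : {linear H -> H} :=
  get [set Q : {linear H -> H} | bounded_op Q /\ is_fun_calc f P Q].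

(* The real power 0 `^ 0 is 1, so that the power of exponent 0 is the identity
   operator, even if P is not injective. *)
Definition op_power P (s : R) : {linear H -> H} := fun_calc (fun u => u `^ s) P.

Definition op_abs T : {linear H -> H} := op_power (adjoint T \o T) 2^-1.

End Operators.

(* Main.v *)
From HB Require Import structures.
Require Import Defs.
From mathcomp Require Import all_boot all_order all_algebra complex.
From mathcomp Require Import sesquilinear ring lra.
From mathcomp Require Import all_classical all_reals all_analysis.

Import Order.TTheory GRing.Theory Num.Theory.
Import numFieldNormedType.Exports.
Local Open Scope ring_scope.

(** Fix a unit vector [x] and write [B] for the adjoint of an entry [A].
    The mixed Schwarz inequality bounds [|<A x, x>|^2] by
    [<F x, x> <G x, x>] with [F = |A|^(2t)] and [G = |B|^(2(1-t))]. Buzano's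
    refinement of Cauchy-Schwarz bounds [|<F x, x> <x, G x>|] by half of
    [|F x| |G x| + |<F x, G x>|], and the arithmetic-geometric mean inequality
    bounds the first product by half of [<F^2 x, x> + <G^2 x, x>], where
    [F^2 = |A|^(4t)] and [G^2 = |B|^(4(1-t))]. Summing over the entries gives
    the operator norm of the sum, and a sum of terms [|<F G x, x>|] that the
    Cauchy-Schwarz inequality in [R^d] bounds by [sqrt d] times the Euclidean
    radius; see [Buzano_product], [mixed_Schwarz] and [sum_Cauchy_Schwarz]. The
    second inequality is the case [t = 1/2].

    Adjoints, absolute values and powers are described by properties that pin
    them down, so one has to show that such operators exist. Adjoints come from
    Riesz' theorem, proved by minimising [|x|^2 - 2 phi x]. For functions of a
    positive operator [P] with [<P x, x> <= M |x|^2], the key is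
    [poly_op_ge0]: a polynomial that is nonnegative on [[0, M]] yields a
    positive operator. It is proved by induction on the degree, dividing by the
    linear factors at a minimiser. It gives the bound [poly_op_norm_le] of the
    norm of [p(P)] by the supremum of [|p|] on [[0, M]]. With the Weierstrass theorem this bound makes polynomial
    approximations of a continuous [f] converge in norm, to a limit that does
    not depend on them ([fun_calcP]).

    The mixed Schwarz inequality is proved by regularisation. For [e > 0] the
    operator [F + e] is positive, and its inverse is [g(|A|)] with
    [g u = (u^(2t) + e)^-1]. Hence [<A x, y> = <(F + e) x, g(|A|) B y>], and the
    Cauchy-Schwarz inequality of the form [<(F + e) x, y>] leaves the factor
    [<A g(|A|) B y, y>]. Since [A |A| = |B| A], that factor is
    [<g(|B|) |B|^2 y, y>], which is at most [<|B|^(2(1-t)) y, y>] because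
    [u^2 g(u) <= u^(2(1-t))]. Then [e] tends to [0]. *)

Local Open Scope complex_scope.

Set Implicit Arguments.
Unset Strict Implicit.
Unset Printing Implicit Defensive.

(** * The inner product *)

Local Notation nrm x := (complex.Re `|x|).

Section ComplexModulus.
Context {R : realType}.
Implicit Types z w : R[i].

Lemma ReD z w : complex.Re (z + w) = complex.Re z + complex.Re w.
Proof. by case: z; case: w. Qed.

Lemma ReN z : complex.Re (- z) = - complex.Re z.
Proof. by case: z. Qed.

Lemma ReZ (a : R) z : complex.Re (a%:C * z) = a * complex.Re z.
Proof. by case: z => x y /=; rewrite mul0r subr0. Qed.

Lemma Re_conj z : complex.Re (Num.conj z) = complex.Re z.
Proof. by case: z. Qed.

Lemma conj_RtoC (a : R) : Num.conj a%:C = a%:C.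
Proof. exact: conjc_real. Qed.

Lemma Re_le_nrm z : complex.Re z <= nrm z.
Proof.
have := normc_ge_Re z; rewrite lecE /= => /andP[_].
exact/le_trans/ler_norm.
Qed.

(** Rotating a vector by [u] turns bounds of real parts into bounds of moduli. *)
Lemma phase z : exists2 u : R[i], `|u| = 1 & complex.Re (u * z) = nrm z.
Proof.
have [->|z0] := eqVneq z 0; first by exists 1; rewrite ?normr1// mul1r normr0.
exists (`|z| / z); last by rewrite divfK.
by rewrite normf_div normr_id divff// normr_eq0.
Qed.

Lemma nrmM z w : nrm (z * w) = nrm z * nrm w.
Proof. by rewrite normrM !normc_def /= !mul0r subr0. Qed.

Lemma nrm_RtoC (a : R) : nrm a%:C = `|a|.
Proof. by rewrite normc_def /= expr0n addr0 sqrtr_sqr. Qed.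

Lemma nrm_conj z : nrm (Num.conj z) = nrm z.
Proof. by rewrite normcJ. Qed.

End ComplexModulus.

Section ComplexNorm.
Context {R : realType} {V : normedZmodType R[i]}.
Implicit Types x y : V.

Lemma nrmE x : `|x| = (nrm x)%:C.
Proof. by rewrite RRe_real// normr_real. Qed.

Lemma nrm_ge0 x : 0 <= nrm x.
Proof. by rewrite -ler0c -nrmE normr_ge0. Qed.

Lemma nrm_triangle x y : nrm (x + y) <= nrm x + nrm y.
Proof. by rewrite -lecR rmorphD /= -!nrmE ler_normD. Qed.

Lemma nrm0 : nrm (0 : V) = 0.
Proof. by rewrite normr0. Qed.

Lemma nrm0_eq0 x : nrm x = 0 -> x = 0.
Proof. by move=> x0; apply/eqP; rewrite -normr_eq0 nrmE x0. Qed.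

Lemma nrmN x : nrm (- x) = nrm x.
Proof. by rewrite normrN. Qed.

Lemma nrm_distC x y : nrm (x - y) = nrm (y - x).
Proof. by rewrite distrC. Qed.

End ComplexNorm.

Section ComplexNormedModule.
Context {R : realType} {V : normedModType R[i]}.
Implicit Types x : V.

Lemma nrmZ (c : R[i]) x : nrm (c *: x) = nrm c * nrm x.
Proof. by rewrite normrZ (nrmE c) (nrmE x) /= !mul0r subr0. Qed.

Lemma nrmZr (a : R) x : nrm (a%:C *: x) = `|a| * nrm x.
Proof. by rewrite nrmZ nrm_RtoC. Qed.

End ComplexNormedModule.

Lemma quadratic_ge0_discr {R : realFieldType} (a b c : R) : 0 <= c ->
  (forall t, 0 <= a + 2 * t * b + t ^+ 2 * c) -> b ^+ 2 <= a * c.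
Proof.
rewrite le_eqVlt => /predU1P[<- h|c0 h].
  rewrite mulr0; have [->|b0] := eqVneq b 0; first by rewrite expr0n.
  have := h (- (a + 1) / (2 * b)); rewrite mulr0 addr0.
  have -> : a + 2 * (- (a + 1) / (2 * b)) * b = - 1 by field.
  lra.
have := h (- b / c); rewrite -(@pmulr_rge0 _ c)//.
have -> : c * (a + 2 * (- b / c) * b + (- b / c) ^+ 2 * c) = a * c - b ^+ 2.
  by field; rewrite gt_eqF.
by rewrite subr_ge0.
Qed.

Section InnerProduct.
Context {R : realType} {H : hilbertType R}.
Implicit Types (x y z e : H) (T S : H -> H).

Definition rip x y : R := complex.Re (hdot x y).

Lemma ripDl x y z : rip (x + y) z = rip x z + rip y z.
Proof. by rewrite /rip linearDl ReD. Qed.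

Lemma ripDr x y z : rip x (y + z) = rip x y + rip x z.
Proof. by rewrite /rip linearDr ReD. Qed.

Lemma ripNl x y : rip (- x) y = - rip x y.
Proof. by rewrite /rip linearNl ReN. Qed.

Lemma ripNr x y : rip x (- y) = - rip x y.
Proof. by rewrite /rip linearNr ReN. Qed.

Lemma ripZl (a : R) x y : rip (a%:C *: x) y = a * rip x y.
Proof. by rewrite /rip linearZl_LR ReZ. Qed.

Lemma ripZr (a : R) x y : rip x (a%:C *: y) = a * rip x y.
Proof. by rewrite /rip linearZr_LR /= conj_RtoC ReZ. Qed.

Lemma hdotC x y : hdot x y = Num.conj (hdot y x).
Proof. by rewrite (hermC hdot) expr0 mul1r. Qed.

Lemma ripC x y : rip x y = rip y x.
Proof. by rewrite /rip hdotC Re_conj. Qed.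

Lemma rip_nrm x : rip x x = nrm x ^+ 2.
Proof. by rewrite /rip hdot_norm (nrmE x) /= mul0r subr0 expr2. Qed.

Lemma hdot_nrm x : hdot x x = (nrm x ^+ 2)%:C.
Proof. by rewrite hdot_norm (nrmE x) rmorphXn. Qed.

Lemma ripI x y : rip ('i *: x) y = - complex.Im (hdot x y).
Proof. by rewrite /rip linearZl_LR /=; case: (hdot x y) => a b /=; lra. Qed.

(** Real parts suffice: take [z = x - y]. *)
Lemma hdot_ext x y : (forall z, rip z x = rip z y) -> x = y.
Proof.
move=> h; apply/eqP; rewrite -subr_eq0; apply/eqP/nrm0_eq0/eqP.
rewrite -sqrf_eq0 -rip_nrm.
by have := h (x - y); rewrite ripDr ripNr => ->; rewrite subrr.
Qed.

Definition adjoint_pair T S := forall x y, hdot (T x) y = hdot x (S y).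

Lemma adjoint_pairC T S : adjoint_pair T S -> adjoint_pair S T.
Proof. by move=> h x y; rewrite hdotC -h -hdotC. Qed.

Lemma adjoint_pair_rip T S x y :
  adjoint_pair T S -> rip (T x) y = rip x (S y).
Proof. by move=> h; rewrite /rip h. Qed.

Definition positive_op T := adjoint_pair T T /\ forall x, 0 <= rip (T x) x.

(** A positive operator defines a semi-inner product. Nonnegativity of the form
    at [x + t y] for real [t] bounds the real part of [<T x, y>], and a rotation
    of [x] makes this real part the whole modulus. *)
Theorem Cauchy_Schwarz_form (T : {linear H -> H}) x y : positive_op T ->
  nrm (hdot (T x) y) ^+ 2 <= rip (T x) x * rip (T y) y.
Proof.
move=> [sT posT].
have real_CS u v : rip (T u) v ^+ 2 <= rip (T u) u * rip (T v) v.
  apply: quadratic_ge0_discr => [|t]; first exact: posT.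
  have := posT (u + t%:C *: v); rewrite linearD linearZ /=.
  rewrite !(ripDl, ripDr, ripZl, ripZr) (adjoint_pair_rip v u sT) (ripC v).
  by congr (_ <= _); ring.
have [u u1 <-] := phase (hdot (T x) y).
have -> : complex.Re (u * hdot (T x) y) = rip (T (u *: x)) y.
  by rewrite linearZ /rip linearZl_LR.
apply: (le_trans (real_CS _ _)).
suff -> : rip (T (u *: x)) (u *: x) = rip (T x) x by [].
by rewrite linearZ /rip linearZl_LR linearZr_LR /= mulrA -normCK u1 expr1n mul1r.
Qed.

Lemma Cauchy_Schwarz x y : nrm (hdot x y) <= nrm x * nrm y.
Proof.
rewrite -(@ler_pXn2r _ 2)// ?nnegrE ?mulr_ge0 ?nrm_ge0// exprMn -!rip_nrm.
by apply: (@Cauchy_Schwarz_form idfun); split => // z; rewrite rip_nrm sqr_ge0.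
Qed.

Lemma rip_le x y : rip x y <= nrm x * nrm y.
Proof. exact: le_trans (Re_le_nrm _) (Cauchy_Schwarz _ _). Qed.

(** [x' = 2 <x, e> e - x] is the reflection of [x] in the line of [e]. It has
    the norm of [x], and [<x', y> = 2 <x, e> <e, y> - <x, y>]; the claim is the
    Cauchy-Schwarz inequality for [x'] and [y]. *)
Theorem Buzano x y (e : H) : nrm e = 1 ->
  nrm (hdot x e) * nrm (hdot e y) <=
  2^-1 * (nrm x * nrm y + nrm (hdot x y)).
Proof.
move=> e1; pose x' := (2%:C * hdot x e) *: e - x.
have nx' : nrm x' = nrm x.
  apply/eqP; rewrite -(@eqrXn2 _ 2)// ?nrm_ge0// -!rip_nrm /rip.
  rewrite /x' !(linearDl, linearDr, linearNl, linearNr) /=.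
  rewrite !(linearZl_LR, linearZr_LR) /= hdot_nrm e1 expr1n mulr1.
  rewrite (hdotC e x) rmorphM /= conj_RtoC.
  have sE (a b : R[i]) : a *: b = a * b by [].
  by rewrite !sE; apply/eqP; congr complex.Re; ring.
have hx' : hdot x' y = 2%:C * (hdot x e * hdot e y) - hdot x y.
  by rewrite /x' linearDl linearNl linearZl_LR /= mulrA.
have := nrm_triangle (hdot x' y) (hdot x y).
rewrite {1}hx' subrK !nrmM (nrm_RtoC 2) (@ger0_norm R)// => h1.
have := Cauchy_Schwarz x' y; rewrite nx' => h2.
lra.
Qed.

End InnerProduct.

(** * Completeness, Riesz' theorem and adjoints *)

(** An explicit null sequence: convergence statements below take the form of
    bounds by a multiple of [rate n]. *)
Definition rate {R : realType} (n : nat) : R := n.+1%:R^-1.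

Lemma rate_gt0 {R : realType} n : 0 < rate n :> R.
Proof. by rewrite invr_gt0 ltr0n. Qed.

Lemma rate_small {R : realType} (K e : R) :
  0 < e -> exists N, forall n, (N <= n)%N -> K * rate n < e.
Proof.
move=> e0; exists (Num.truncn (`|K| / e)).+1 => n Nn.
rewrite (le_lt_trans (ler_wpM2r (ltW (rate_gt0 n)) (ler_norm K)))//.
rewrite ltr_pdivrMr ?ltr0n// mulrC -ltr_pdivrMr//.
rewrite (lt_le_trans (truncnS_gt _))// ler_nat (leq_trans Nn)//.
Qed.

(** Lets an error term linear in [rate n] vanish. *)
Lemma le_of_rate {R : realType} (a b K : R) :
  (forall n, a <= b + K * rate n) -> a <= b.
Proof.
move=> h; apply/ler_addgt0Pr => e e0.
have [N /(_ N (leqnn N)) hN] := rate_small K e0.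
by rewrite (le_trans (h N))// lerD2l ltW.
Qed.

Section Completeness.
Context {R : realType} {V : completeNormedModType R[i]}.

(** Turns completeness, a statement on Cauchy filters over complex radii, into
    real estimates. *)
Lemma complete_rate (u : nat -> V) (K : R) :
  (forall m n, nrm (u m - u n) <= K * (rate m + rate n)) ->
  exists l, forall n, nrm (u n - l) <= K * rate n.
Proof.
move=> hu; have K0 : 0 <= K.
  have := le_trans (nrm_ge0 _) (hu 0%N 0%N).
  by rewrite pmulr_lge0 ?addr_gt0 ?rate_gt0.
have /cauchy_exP/cauchy_cvg cu : cauchy_ex (u @ \oo)%classic.
  move=> e e0; have : e \is Num.real by rewrite realE ltW.
  move=> /RRe_real eE; rewrite -eE ltcR in e0.
  have [N hN] := rate_small (K + K) e0.
  exists (u N); exists N => // n /= Nn.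
  rewrite -ball_normE /= -eE nrmE ltcR (le_lt_trans (hu _ _))//.
  rewrite (le_lt_trans _ (hN N (leqnn N)))// mulrDl -mulrDr ler_wpM2l//.
  by rewrite lerD2l lef_pV2 ?posrE ?ltr0n// ler_nat.
exists (lim (u @ \oo)%classic) => n; apply/ler_addgt0Pr => e e0.
have /cvgrPdist_lt/(_ (e / 2)%:C) := cu.
rewrite (ltcR 0) divr_gt0// => /(_ isT)[N1 _ hN1].
have [N2 hN2] := rate_small K (divr_gt0 e0 (ltr0n _ 2)).
pose m := maxn N1 N2; have := hN1 m (leq_maxl _ _).
rewrite /= nrmE ltcR nrm_distC => h1.
have h2 := hN2 m (leq_maxr _ _).
have := nrm_triangle (u n - u m) (u m - lim (u @ \oo)%classic).
have := hu n m; rewrite mulrDr addrA subrK; lra.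
Qed.

End Completeness.

Section Bounds.
Context {R : realType} {H : hilbertType R}.
Implicit Types (T S : {linear H -> H}).

(** Real-valued bounds replace neighbourhoods and suprema in every estimate;
    [bounded_opP] and [opnorm_le] translate. *)
Definition bound (M : R) (T : H -> H) :=
  0 <= M /\ forall x, nrm (T x) <= M * nrm x.

Lemma bounded_opP T : bounded_op T <-> exists M, bound M T.
Proof.
split=> [/linear_boundedP/pinfty_ex_gt0 [r r0 hr]|[M [M0 hM]]].
  exists (complex.Re r); have rE : (complex.Re r)%:C = r by rewrite RRe_real// realE ltW.
  split=> [|x]; first by rewrite -ler0c rE ltW.
  by have := hr x; rewrite (nrmE x) (nrmE (T x)) -{1}rE -rmorphM lecR.
apply/linear_boundedP; exists M%:C; split=> [|r]; first by rewrite complex_real.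
move=> Mr x; rewrite (le_trans _ (ler_wpM2r (normr_ge0 x) (ltW Mr)))//.
by rewrite (nrmE x) (nrmE (T x)) -rmorphM lecR.
Qed.

Lemma opnorm_le M (T : H -> H) : bound M T -> opnorm T <= M.
Proof.
move=> [M0 hM]; apply: ge_sup => [|_ /= [x x1 <-]].
  by exists (nrm (T 0)); exists 0 => //=; rewrite normr0.
rewrite (le_trans (hM x))// ler_piMr//.
by move: x1; rewrite (nrmE x) (lecR _ 1).
Qed.

Lemma le_opnorm M T : bound M T -> forall x, nrm (T x) <= opnorm T * nrm x.
Proof.
move=> [M0 hM] x; have [x0|x0] := eqVneq (nrm x) 0.
  by rewrite (nrm0_eq0 x0) linear0 nrm0 mulr0.
have {}x0 : 0 < nrm x by rewrite lt_neqAle eq_sym x0 nrm_ge0.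
rewrite -ler_pdivrMr// mulrC -[X in X * _]ger0_norm ?invr_ge0 ?nrm_ge0// -nrmZr.
apply: ub_le_sup.
  exists M => _ /= [y y1 <-]; rewrite (le_trans (hM y))// ler_piMr//.
  by move: y1; rewrite (nrmE y) (lecR _ 1).
exists ((nrm x)^-1%:C *: x); last by rewrite linearZ.
rewrite /= nrmE (lecR _ 1) nrmZr ger0_norm ?invr_ge0 ?nrm_ge0//.
by rewrite mulVf// gt_eqF.
Qed.

Lemma opnorm_ge0 (T : H -> H) : 0 <= opnorm T.
Proof.
rewrite /opnorm; set E := (X in sup X).
have E0 : E (nrm (T 0)) by exists 0 => //=; rewrite normr0.
have [hE|hE] := pselect (has_sup E).
  by rewrite (le_trans (nrm_ge0 (T 0)))// ub_le_sup//; case: hE.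
by rewrite sup_out.
Qed.

Lemma bound_comp M N (T S : H -> H) :
  bound M T -> bound N S -> bound (M * N) (T \o S).
Proof.
move=> [M0 hM] [N0 hN]; split=> [|x]; first exact: mulr_ge0.
by rewrite /= (le_trans (hM _))// -mulrA ler_wpM2l.
Qed.

End Bounds.

Section Adjoint.
Context {R : realType} {H : hilbertType R}.
Implicit Types (T S : {linear H -> H}).

(** A minimising sequence of [J x = |x|^2 - 2 phi x] is Cauchy by the
    parallelogram law, and its limit [z] represents [phi] because the
    derivative of [J] vanishes there. The functional is real-valued and linear
    over the reals; [hdot_rip] recovers the complex statement. *)
Theorem Riesz (phi : H -> R) (K : R) :
  (forall x y, phi (x + y) = phi x + phi y) ->
  (forall a x, phi (a%:C *: x) = a * phi x) ->
  (forall x, phi x <= K * nrm x) ->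
  exists z, forall x, phi x = rip x z.
Proof.
move=> phiD phiZ phiK.
pose J x := nrm x ^+ 2 - 2 * phi x.
pose E := [set J x | x in [set: H]]%classic.
have hE : has_inf E.
  split; first by exists (J 0); exists 0.
  exists (- K ^+ 2) => _ [x _ <-]; rewrite /J.
  by have := phiK x; have := sqr_ge0 (nrm x - K); rewrite sqrrB; lra.
have Jinf x : inf E <= J x by apply: ge_inf => //; [case: hE|exists x].
have Jpar x y : nrm (x - y) ^+ 2 + 4 * J (2^-1%:C *: (x + y)) = 2 * J x + 2 * J y.
  rewrite /J phiZ phiD -!rip_nrm !(ripZl, ripZr).
  by rewrite !(ripDl, ripDr, ripNl, ripNr) (ripC y x); field.
have /choice [u hu] : forall n, exists x, J x < inf E + rate n ^+ 2.
  move=> n; have [_ [x _ <-] hx] := inf_adherent (exprn_gt0 2 (rate_gt0 n)) hE.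
  by exists x.
have /complete_rate [z hz] : forall m n, nrm (u m - u n) <= 2 * (rate m + rate n).
  move=> m n; have rm := @rate_gt0 R m; have rn := @rate_gt0 R n.
  rewrite -(@ler_pXn2r _ 2)// ?nnegrE ?nrm_ge0 ?mulr_ge0 ?addr_ge0 ?ltW//.
  have := Jpar (u m) (u n); have := Jinf (2^-1%:C *: (u m + u n)).
  have := hu m; have := hu n; have := mulr_gt0 rm rn.
  by rewrite exprMn sqrrD; nra.
exists z => x.
(* J is within (rate n)^2 of its infimum at u n, so the quadratic polynomial
   s |-> J (u n + s x) - J (u n) is at least - (rate n)^2, and its linear
   coefficient is therefore small. *)
have near n (s : R) : rate n ^+ 2 + 2 * s * (rip x (u n) - phi x)
    + s ^+ 2 * nrm x ^+ 2 >= 0.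
  have := Jinf (u n + s%:C *: x); have := hu n.
  rewrite /J phiD phiZ -!rip_nrm !(ripDl, ripDr, ripZl, ripZr) (ripC (u n) x); lra.
have gap n : `|rip x (u n) - phi x| <= nrm x * rate n.
  have := quadratic_ge0_discr (sqr_ge0 (nrm x)) (near n).
  rewrite -exprMn -real_normK ?num_real// ler_pXn2r ?nnegrE ?mulr_ge0 ?nrm_ge0//.
    by rewrite mulrC.
  by rewrite ltW ?rate_gt0.
have gap' n : `|rip x z - phi x| <= 0 + (3 * nrm x) * rate n.
  have := gap n; have := rip_le x (u n - z); have := rip_le x (z - u n).
  rewrite (nrm_distC z) !(ripDr, ripNr) !ler_norml.
  have := ler_wpM2l (nrm_ge0 x) (hz n); lra.
have := le_of_rate gap'; rewrite normr_le0 subr_eq0 => /eqP -> //.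
Qed.

Lemma hdot_rip (x y z w : H) : rip x y = rip z w ->
  rip ('i *: x) y = rip ('i *: z) w -> hdot x y = hdot z w.
Proof.
rewrite !ripI /rip; case: (hdot x y) => a b; case: (hdot z w) => c d /= -> h.
by congr (_ +i* _); lra.
Qed.

Lemma adjoint_exists M T : bound M T ->
  exists2 S : {linear H -> H}, bound M S & adjoint_pair T S.
Proof.
move=> [M0 hM].
have /choice [S hS] : forall y, exists z, forall x, rip (T x) y = rip x z.
  move=> y; apply: (@Riesz (fun x => rip (T x) y) (M * nrm y)) => [x x'|a x|x].
  - by rewrite linearD ripDl.
  - by rewrite linearZ ripZl.
  - by rewrite (le_trans (rip_le _ _))// mulrAC ler_wpM2r ?nrm_ge0.
have TS : adjoint_pair T S.
  by move=> x y; apply: hdot_rip; rewrite -?linearZ hS.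
have linS : linear S.
  move=> a x y; apply: hdot_ext => z.
  congr complex.Re; rewrite -(TS z (a *: x + y)) [LHS]linearDr [RHS]linearDr.
  rewrite [in LHS]linearZr_LR [in RHS]linearZr_LR /=.
  by congr (_ * _ + _); exact: TS.
pose SL : {linear H -> H} := HB.pack S (GRing.isLinear.Build _ _ _ _ S linS).
exists SL => //; split=> // y; have [y0|y0] := eqVneq (nrm (SL y)) 0.
  by rewrite y0 mulr_ge0 ?nrm_ge0.
have {}y0 : 0 < nrm (SL y) by rewrite lt_neqAle eq_sym y0 nrm_ge0.
rewrite -(ler_pM2l y0) -expr2 -rip_nrm -hS (le_trans (rip_le _ _))//.
by rewrite mulrA ler_wpM2r ?nrm_ge0// mulrC.
Qed.

Lemma adjointP M T : bound M T -> adjoint_pair T (adjoint T) /\ bound M (adjoint T).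
Proof.
move=> bT; have [S bS TS] := adjoint_exists bT.
have /(@getPex _) [_ TA] : (exists S : {linear H -> H}, bounded_op S /\
    forall x y : H, hdot (T x) y = hdot x (S y)).
  by exists S; split => //; apply/bounded_opP; exists M.
split=> //; suff -> : adjoint T = S :> (H -> H) by [].
by apply/funext => y; apply: hdot_ext => z; rewrite /rip -TA TS.
Qed.

End Adjoint.

(** * Polynomials of a positive operator *)

Section PolyOp.
Context {R : realType} {H : hilbertType R}.
Implicit Types (P T : {linear H -> H}) (p q : {poly R}) (x y : H).

Lemma iterD_lin n T x y : iter n T (x + y) = iter n T x + iter n T y.
Proof. by elim: n => //= n ->; rewrite linearD. Qed.

Lemma iterZ_lin n T (a : R[i]) x : iter n T (a *: x) = a *: iter n T x.
Proof. by elim: n => //= n ->; rewrite linearZ. Qed.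

Lemma poly_op_linear p P : linear (poly_op p P).
Proof.
move=> a x y; rewrite /poly_op scaler_sumr -big_split /=; apply: eq_bigr => i _.
by rewrite iterD_lin iterZ_lin scalerDr !scalerA mulrC.
Qed.

HB.instance Definition _ p P :=
  GRing.isLinear.Build R[i] H H _ (poly_op p P) (@poly_op_linear p P).

Lemma poly_op_widen n p (P : H -> H) x : (size p <= n)%N ->
  poly_op p P x = \sum_(i < n) (p`_i)%:C *: iter i P x.
Proof.
move=> pn; rewrite /poly_op (big_ord_widen n (fun i => (p`_i)%:C *: iter i P x))//.
rewrite big_mkcond /=; apply: eq_bigr => i _; case: ltnP => // pi.
by rewrite nth_default// scale0r.
Qed.

Lemma poly_opD p q (P : H -> H) x : poly_op (p + q) P x = poly_op p P x + poly_op q P x.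
Proof.
pose n := maxn (size (p + q)) (maxn (size p) (size q)).
rewrite !(@poly_op_widen n) ?leq_max ?leqnn ?orbT// -big_split /=.
by apply: eq_bigr => i _; rewrite coefD rmorphD scalerDl.
Qed.

Lemma poly_opC c (P : H -> H) x : poly_op c%:P P x = c%:C *: x.
Proof.
by rewrite (@poly_op_widen 1) ?size_polyC ?leq_b1// big_ord1 coefC.
Qed.

Lemma poly_opMX p (P : H -> H) x : poly_op (p * 'X) P x = poly_op p P (P x).
Proof.
rewrite (@poly_op_widen (size p).+1).
  rewrite big_ord_recl coefMX /= scale0r add0r; apply: eq_bigr => i _.
  by rewrite coefMX /= -iterS iterSr.
by rewrite (leq_trans (size_polyMleq _ _))// size_polyX addn2.
Qed.

Lemma poly_opX (P : H -> H) x : poly_op 'X P x = P x.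
Proof. by rewrite -['X]mul1r poly_opMX -[1]/(1%:P) poly_opC scale1r. Qed.

Lemma poly_op_intertwine (A P Q : {linear H -> H}) p x :
  (forall y, A (P y) = Q (A y)) -> A (poly_op p P x) = poly_op p Q (A x).
Proof.
move=> AP; rewrite /poly_op linear_sum; apply: eq_bigr => i _.
rewrite linearZ; congr (_ *: _); elim: (i : nat) => //= n <-.
exact: AP.
Qed.

Lemma poly_opMC p c P x : poly_op (p * c%:P) P x = poly_op p P (c%:C *: x).
Proof.
rewrite linearZ /= mulrC mul_polyC (@poly_op_widen (size p)) ?size_scale_leq//.
rewrite /poly_op scaler_sumr; apply: eq_bigr => i _.
by rewrite coefZ rmorphM scalerA.
Qed.

Lemma poly_opM p q P x : poly_op (p * q) P x = poly_op p P (poly_op q P x).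
Proof.
elim/poly_ind: q x => [|q c IH] x.
  by rewrite mulr0 -[0]/(0%:P) !poly_opC scale0r linear0.
by rewrite mulrDr mulrA !poly_opD !poly_opMX IH linearD poly_opMC poly_opC.
Qed.

Lemma poly_op_self_adjoint p P : adjoint_pair P P -> adjoint_pair (poly_op p P) (poly_op p P).
Proof.
move=> sP x y; elim/poly_ind: p x y => [|p c IH] x y.
  by rewrite -[0]/(0%:P) !poly_opC linearZl_LR linearZr_LR /= conj_RtoC.
rewrite !poly_opD !poly_opMX !poly_opC linearDl linearDr linearZl_LR linearZr_LR /=.
by rewrite conj_RtoC IH sP (@poly_op_intertwine P P P).
Qed.

End PolyOp.

(** Used to extend the sign of a quotient of polynomials to a zero of the
    divisor. *)
Lemma horner_ge0_cluster {R : realType} (q : {poly R}) c :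
  (forall d, 0 < d -> exists2 u, `|u - c| < d & 0 <= q.[u]) -> 0 <= q.[c].
Proof.
move=> h; apply/ler_addgt0Pr => e e0.
have /cvgrPdist_lt/(_ e e0)/nbhs_ballP[d d0 hd] := @continuous_horner R q c.
have [u uc qu] := h d d0.
have := hd u; rewrite /ball /= distrC => /(_ uc); rewrite ltr_norml; lra.
Qed.

Lemma horner_min {R : realType} (p : {poly R}) (M : R) : 0 <= M ->
  exists2 c, 0 <= c <= M & forall u, 0 <= u <= M -> p.[c] <= p.[u].
Proof.
move=> M0; have [|c] := @EVT_min R (horner p) 0 M M0.
  by apply: continuous_subspaceT => x; exact: continuous_horner.
by rewrite in_itv => cM hc; exists c => // u uM; rewrite hc// in_itv.
Qed.

Definition nonneg_on {R : realType} (M : R) (p : {poly R}) :=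
  forall u, 0 <= u <= M -> 0 <= p.[u].

Section PolynomialPositivity.
Context {R : realType} {H : hilbertType R}.
Variables (P : {linear H -> H}) (M : R).
Implicit Types (p q s : {poly R}) (x : H).

(** For a bounded self-adjoint operator this says that the spectrum lies in
    [[0, M]]. *)
Definition numrange_in (M : R) (P : H -> H) :=
  adjoint_pair P P /\ forall x, 0 <= rip (P x) x <= M * nrm x ^+ 2.

Hypothesis PM : numrange_in M P.
Let sP : adjoint_pair P P. Proof. by case: PM. Qed.

Definition poly_pos p := forall x, 0 <= rip (poly_op p P x) x.

Let posD p q : poly_pos p -> poly_pos q -> poly_pos (p + q).
Proof. by move=> hp hq x; rewrite poly_opD ripDl addr_ge0. Qed.

Let posC p c : 0 <= c -> poly_pos p -> poly_pos (p * c%:P).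
Proof. by move=> c0 hp x; rewrite poly_opMC linearZ ripZl mulr_ge0//; exact: hp. Qed.

Let posM s p : poly_pos p -> poly_pos (s * p * s).
Proof.
by move=> hp x; rewrite !poly_opM (adjoint_pair_rip _ _ (poly_op_self_adjoint s sP)).
Qed.

Local Notation M_X := (M%:P - 'X).

Let pos1 : poly_pos 1.
Proof. by move=> x; rewrite -[1]/(1%:P) poly_opC scale1r rip_nrm sqr_ge0. Qed.

Let posX : poly_pos 'X.
Proof. by move=> x; rewrite poly_opX; case: PM => _ /(_ x)/andP[]. Qed.

Let posM_X : poly_pos M_X.
Proof.
move=> x; rewrite poly_opD poly_opC -mulN1r -[1]/(1%:P) -polyCN mulrC.
rewrite poly_opMC poly_opX linearZ /= ripDl !ripZl rip_nrm.
by case: PM => _ /(_ x)/andP[]; lra.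
Qed.

(** [M X (M - X) = X (M - X) X + (M - X) X (M - X)], and each term on the right
    is a positive operator conjugated by a self-adjoint one. *)
Let posXM_X : 0 < M -> poly_pos ('X * M_X).
Proof.
move=> M0; have -> : 'X * M_X = ('X * M_X * 'X + M_X * 'X * M_X) * (M^-1)%:P.
  have MM : M%:P * (M^-1)%:P = 1 :> {poly R} by rewrite -polyCM divff ?gt_eqF.
  rewrite -[LHS]mulr1 -MM; ring.
apply: posC; first by rewrite invr_ge0 ltW.
by apply: posD; apply: posM; [exact: posM_X|exact: posX].
Qed.

(** Multiplying [p] by [X] or by [M - X] permutes these four conditions up to
    square factors, which [posM] absorbs; so the conjunction is stable where
    [poly_pos] alone is not. *)
Definition weighted_pos p := [/\ poly_pos p, poly_pos ('X * p),
  poly_pos (M_X * p) & poly_pos ('X * M_X * p)].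

Let wposD p q : weighted_pos p -> weighted_pos q -> weighted_pos (p + q).
Proof. by move=> [? ? ? ?] [? ? ? ?]; split; rewrite ?(mulrDr _ p q); apply: posD; assumption. Qed.

Let wposX p : weighted_pos p -> weighted_pos ('X * p).
Proof.
move=> [h1 hX hM hXM]; split=> //.
- by rewrite mulrA mulrAC; exact: posM.
- by rewrite mulrA (mulrC M_X).
- rewrite (_ : _ * _ = 'X * (M_X * p) * 'X); last by ring.
  exact: posM.
Qed.

Let wposM_X p : weighted_pos p -> weighted_pos (M_X * p).
Proof.
move=> [h1 hX hM hXM]; split=> //.
- by rewrite mulrA.
- by rewrite mulrA mulrAC; exact: posM.
- rewrite (_ : _ * _ = M_X * ('X * p) * M_X); last by ring.
  exact: posM.
Qed.

Let wposM s p : weighted_pos p -> weighted_pos (s * p * s).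
Proof.
move=> [h1 hX hM hXM]; split.
- exact: posM.
- by rewrite (_ : _ * _ = s * ('X * p) * s); [exact: posM|ring].
- by rewrite (_ : _ * _ = s * (M_X * p) * s); [exact: posM|ring].
- by rewrite (_ : _ * _ = s * ('X * M_X * p) * s); [exact: posM|ring].
Qed.

Let wposC c : 0 < M -> 0 <= c -> weighted_pos c%:P.
Proof.
move=> M0 c0; split; [rewrite -[c%:P]mul1r| | |]; apply: posC => //.
exact: posXM_X.
Qed.

Let size_div p q c : p = q * ('X - c%:P) -> (size q <= (size p).-1)%N.
Proof.
move=> ->; have [->|q0] := eqVneq q 0; first by rewrite size_poly0.
by rewrite size_Mmonic ?monicXsubC// size_XsubC addn2.
Qed.

(** Let [c] minimise [p] on [[0, M]]. Then [p - p(c)] is [X q] if [c = 0], is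
    [(M - X) q] if [c = M], and otherwise is [(X - c)^2 r] because an interior
    minimum is a double zero. The quotient is nonnegative on [[0, M]] and has
    smaller degree, and each of the three factors preserves [weighted_pos]. *)
Let wpos_nonneg n p : 0 < M -> (size p <= n)%N -> nonneg_on M p -> weighted_pos p.
Proof.
move=> M0; elim/ltn_ind: n p => n IH p pn p0.
have [p1|p1] := leqP (size p) 1.
  rewrite (size1_polyC p1); apply: wposC => //.
  by rewrite -horner_coef0 p0// lexx ltW.
have [c /andP[c0 cM] cmin] := horner_min p (ltW M0).
have [q hq] : exists q, p - p.[c]%:P = q * ('X - c%:P).
  by apply/factor_theorem; rewrite rootE !hornerE subrr.
have qE u : p.[u] = p.[c] + q.[u] * (u - c).
  by have := congr1 (horner^~ u) hq; rewrite !hornerE => /eqP; rewrite subr_eq addrC => /eqP.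
have qu u : 0 <= u <= M -> 0 <= q.[u] * (u - c).
  by move=> /cmin; rewrite (qE u) lerDl.
have sq : (size q < n)%N.
  have sp : size (p - p.[c]%:P) = size p.
    by rewrite size_polyDl// size_polyN (leq_ltn_trans (size_polyC_leq1 _)).
  by have := size_div hq; rewrite sp => /leq_ltn_trans; apply; case: (size p) p1 pn.
have -> : p = p.[c]%:P + q * ('X - c%:P) by rewrite -hq addrC subrK.
apply: wposD; first by apply: wposC => //; rewrite p0// c0.
have qr u : c < u -> u <= M -> 0 <= q.[u].
  move=> cu uM; rewrite -(@pmulr_lge0 _ (u - c)) ?subr_gt0// qu// uM.
  by rewrite (le_trans c0 (ltW cu)).
have ql u : 0 <= u -> u < c -> q.[u] <= 0.
  move=> u0 uc; have := qu u; rewrite u0 (le_trans (ltW uc) cM) => /(_ isT).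
  by rewrite nmulr_lge0 ?subr_lt0.
have near_r d : c < M -> 0 < d -> exists2 u, `|u - c| < d & c < u <= M.
  move=> cM' d0; exists (c + Num.min (d / 2) (M - c)).
    rewrite addrC addKr ger0_norm; last by rewrite le_min; lra.
    by rewrite gt_min; apply/orP; left; lra.
  by rewrite ltrDl lt_min -lerBrDl ge_min lexx orbT; lra.
have near_l d : 0 < c -> 0 < d -> exists2 u, `|u - c| < d & 0 <= u < c.
  move=> c0' d0; exists (c - Num.min (d / 2) c).
    rewrite addrC addKr normrN ger0_norm; last by rewrite le_min; lra.
    by rewrite gt_min; apply/orP; left; lra.
  by rewrite subr_ge0 ge_min lexx orbT ltrBlDr ltrDl lt_min; lra.
have [c0'|c0'] := eqVneq c 0.
  rewrite c0' subr0 mulrC; apply: wposX; apply: (IH _ sq) => // u /andP[u0 uM].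
  have [u0'|u0'] := eqVneq u c; last by rewrite qr// lt_neqAle eq_sym u0' c0'.
  rewrite u0'; apply: horner_ge0_cluster => d d0.
  have [|v vd /andP[cv vM]] := near_r d _ d0; first by rewrite c0'.
  by exists v => //; exact: qr.
have {}c0' : 0 < c by rewrite lt_neqAle eq_sym c0'.
have [cM'|cM'] := eqVneq c M.
  rewrite (_ : _ * _ = M_X * (- q)); last by rewrite cM'; ring.
  apply: wposM_X; apply: (IH _ sq) => [|u /andP[u0 uM]]; first by rewrite size_polyN.
  have [u0'|u0'] := eqVneq u c; last first.
    by rewrite hornerN oppr_ge0 ql// lt_neqAle u0' cM'.
  rewrite u0'; apply: horner_ge0_cluster => d d0.
  have [v vd /andP[v0 vc]] := near_l d c0' d0.
  by exists v => //; rewrite hornerN oppr_ge0 ql.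
have {}cM' : c < M by rewrite lt_neqAle cM'.
have qc : q.[c] = 0.
  apply/eqP; rewrite eq_le -oppr_ge0 -hornerN; apply/andP; split.
    apply: horner_ge0_cluster => d d0; have [v vd /andP[v0 vc]] := near_l d c0' d0.
    by exists v => //; rewrite hornerN oppr_ge0 ql.
  apply: horner_ge0_cluster => d d0; have [v vd /andP[cv vM]] := near_r d cM' d0.
  by exists v => //; exact: qr.
have [r hr] : exists r, q = r * ('X - c%:P) by apply/factor_theorem; rewrite rootE qc.
have rE u : q.[u] = r.[u] * (u - c) by rewrite hr !hornerE.
rewrite (_ : _ * _ = ('X - c%:P) * r * ('X - c%:P)); last by rewrite hr; ring.
apply: wposM; apply: (IH (size r)) => //.
  by rewrite (leq_ltn_trans (size_div hr))// (leq_ltn_trans (leq_pred _)).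
have r0 u : 0 <= u <= M -> u != c -> 0 <= r.[u].
  move=> uM uc; have := qu u uM; rewrite rE -mulrA -expr2 pmulr_lge0//.
  by rewrite exprn_even_gt0//= subr_eq0.
move=> u uM; have [->|uc] := eqVneq u c; last exact: r0.
apply: horner_ge0_cluster => d d0; have [v vd /andP[cv vM]] := near_r d cM' d0.
by exists v => //; rewrite r0 ?gt_eqF// vM (le_trans c0 (ltW cv)).
Qed.

(** If [M = 0] then [P] vanishes by Cauchy-Schwarz, and only the constant term
    of [p] remains. *)
Theorem poly_op_ge0 p x : 0 <= M -> nonneg_on M p -> 0 <= rip (poly_op p P x) x.
Proof.
rewrite le_eqVlt => /predU1P[M0 p0|M0 p0]; last first.
  by have [] := wpos_nonneg M0 (leqnn _) p0.
have Px y : P y = 0.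
  have posP : positive_op P by split=> // z; case: PM => _ /(_ z)/andP[].
  have Pyy : rip (P y) y = 0.
    by case: PM => _ /(_ y); rewrite -M0 mul0r -eq_le => /eqP.
  have := Cauchy_Schwarz_form y (P y) posP.
  rewrite Pyy mul0r hdot_nrm nrm_RtoC ger0_norm ?sqr_ge0// -exprM.
  rewrite le_eqVlt [X in _ || X]ltNge exprn_even_ge0// orbF expf_eq0 /=.
  by move=> /eqP/nrm0_eq0.
have {1}-> : p = (p - p.[0]%:P) + p.[0]%:P by rewrite subrK.
have [q ->] : exists q, p - p.[0]%:P = q * ('X - 0%:P).
  by apply/factor_theorem; rewrite rootE !hornerE subrr.
rewrite subr0 poly_opD poly_opMX Px linear0 add0r poly_opC ripZl rip_nrm.
by rewrite mulr_ge0 ?sqr_ge0// p0// -M0 lexx.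
Qed.

(** [e^2 - p^2] is nonnegative on [[0, M]]. *)
Theorem poly_op_norm_le p e x : 0 <= M -> 0 <= e ->
  (forall u, 0 <= u <= M -> `|p.[u]| <= e) -> nrm (poly_op p P x) <= e * nrm x.
Proof.
move=> M0 e0 pe; rewrite -(@ler_pXn2r _ 2)// ?nnegrE ?mulr_ge0 ?nrm_ge0//.
have : 0 <= rip (poly_op ((e ^+ 2)%:P + (p * p) * (-1)%:P) P x) x.
  apply: poly_op_ge0 => // u /pe; rewrite !hornerE ler_norml; nra.
rewrite poly_opD poly_opC poly_opMC poly_opM !linearZ /= ripDl !ripZl rip_nrm.
rewrite (adjoint_pair_rip _ _ (poly_op_self_adjoint p sP)) rip_nrm exprMn.
lra.
Qed.

Lemma numrange_norm_le x : 0 <= M -> nrm (P x) <= M * nrm x.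
Proof.
move=> M0; rewrite -poly_opX; apply: poly_op_norm_le => // u /andP[u0 uM].
by rewrite hornerX ger0_norm.
Qed.

End PolynomialPositivity.

(** * Uniform approximation by polynomials *)

Section Weierstrass.
Context {R : realType}.
Implicit Types (f g : R -> R) (h k : nat -> R) (M : R).

(** Only values on [[0, M]] count, since [u `^ s] need not be continuous at [0]
    from the left. *)
Definition continuous_on M f := forall x e, 0 <= x <= M -> 0 < e ->
  exists2 d, 0 < d & forall y, 0 <= y <= M -> `|x - y| < d -> `|f x - f y| < e.

Definition unif_approx M f := forall e, 0 < e ->
  exists p : {poly R}, forall u, 0 <= u <= M -> `|p.[u] - f u| <= e.

Lemma Heine M f : continuous_on M f -> forall e, 0 < e -> exists2 d, 0 < d &
  forall x y, 0 <= x <= M -> 0 <= y <= M -> `|x - y| < d -> `|f x - f y| < e.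
Proof.
move=> cf e e0.
pose Q (d x : R) := 0 <= x <= M ->
  forall y, 0 <= y <= M -> `|x - y| < d -> `|f x - f y| < e.
have /compact_near_coveringP/(_ R (at_right 0) Q) := @segment_compact R 0 M.
case=> [x|].
  rewrite /= in_itv /= => xM; have [d d0 hd] := cf x (e / 2) xM (divr_gt0 e0 (ltr0n _ 2)).
  exists (ball x (d / 2), [set r | r < d / 2]%classic).
    split; first by apply: nbhsx_ballx; rewrite divr_gt0.
    by apply: nbhs_right_lt; rewrite divr_gt0.
  move=> [z r] [/= xz rd] zM y yM zy.
  rewrite /ball /= in xz.
  have h1 := hd z zM; have h2 := hd y yM.
  have : `|x - z| < d by lra.
  have : `|x - y| < d by rewrite -(subrKA z) (le_lt_trans (ler_normD _ _))//; lra.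
  move=> /h2 + /h1; rewrite !ltr_norml; lra.
move=> d /= d0 hd; exists (d / 2); first by rewrite divr_gt0.
move=> x y xM yM xy; apply: (hd (d / 2)) => //=.
  by rewrite sub0r normrN gtr0_norm ?divr_gt0//; lra.
by rewrite divr_gt0.
Qed.

Lemma continuous_on_bounded M f : continuous_on M f ->
  exists2 B, 0 < B & forall x, 0 <= x <= M -> `|f x| <= B.
Proof.
move=> cf; pose Q (B x : R) := 0 <= x <= M -> `|f x| <= B.
have /compact_near_coveringP/(_ R (pinfty_nbhs R) Q) := @segment_compact R 0 M.
case=> [x|].
  rewrite /= in_itv /= => xM; have [d d0 hd] := cf x 1 xM ltr01.
  exists (ball x d, [set r | `|f x| + 1 <= r]%classic).
    by split; [exact: nbhsx_ballx|exact: nbhs_pinfty_ge].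
  move=> [z r] [/= xz fr] zM; have := hd z zM xz.
  have := ler_normB (f x) (f x - f z); rewrite opprB addrC subrK; lra.
move=> B [_ hB]; exists (Num.max 1 (B + 1)); first by rewrite lt_max ltr01.
move=> x xM; apply: (hB (Num.max 1 (B + 1))) => //=.
by rewrite lt_max ltrDl ltr01 orbT.
Qed.

(** [bernstein n h] evaluates at [u] to the mean of [h N], with [N] binomial of
    parameters [n] and [u]. Conditioning on the first trial gives a recursion,
    which makes its properties inductions without binomial coefficients. *)
Fixpoint bernstein n h : {poly R} :=
  if n is m.+1 then 'X * bernstein m (h \o S) + (1 - 'X) * bernstein m h
  else (h 0%N)%:P.

Lemma horner_bernsteinS n h u : (bernstein n.+1 h).[u] =
  u * (bernstein n (h \o S)).[u] + (1 - u) * (bernstein n h).[u].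
Proof. by rewrite /= !hornerE. Qed.

Lemma bernsteinD n h k u :
  (bernstein n (fun i => h i + k i)).[u] = (bernstein n h).[u] + (bernstein n k).[u].
Proof.
elim: n h k => [|n IH] h k; first by rewrite !hornerC.
rewrite !horner_bernsteinS.
rewrite (IH (h \o S) (k \o S)) IH; ring.
Qed.

Lemma bernsteinZ n a h u :
  (bernstein n (fun i => a * h i)).[u] = a * (bernstein n h).[u].
Proof.
elim: n h => [|n IH] h; first by rewrite !hornerC.
rewrite !horner_bernsteinS.
rewrite (IH (h \o S)) IH; ring.
Qed.

Lemma bernstein_cst n a u : (bernstein n (fun=> a)).[u] = a.
Proof.
elim: n => [|n IH]; first by rewrite hornerC.
rewrite horner_bernsteinS.
rewrite -[_ \o S]/(fun=> a) IH; ring.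
Qed.

Lemma bernstein_le n h k u : 0 <= u <= 1 ->
  (forall i, (i <= n)%N -> h i <= k i) -> (bernstein n h).[u] <= (bernstein n k).[u].
Proof.
move=> /andP[u0 u1]; elim: n h k => [|n IH] h k hk; first by rewrite !hornerC hk.
rewrite !horner_bernsteinS.
apply: lerD; apply: ler_wpM2l; rewrite ?subr_ge0//; apply: IH => i ni.
  exact: hk.
by rewrite hk// (leq_trans ni).
Qed.

(** The mean of a binomial variable [N] of parameters [n] and [u] is [n u] and
    its variance is [n u (1 - u)]; this computes the mean of [(N - a)^2]. *)
Lemma bernstein_variance n (a u : R) :
  (bernstein n (fun i => (i%:R - a) ^+ 2)).[u] =
  (n%:R * u - a) ^+ 2 + n%:R * (u * (1 - u)).
Proof.
elim: n a => [|n IH] a; first by rewrite hornerC; ring.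
rewrite horner_bernsteinS.
have -> : (fun i => (i%:R - a) ^+ 2) \o S = (fun i => (i%:R - (a - 1)) ^+ 2).
  by apply/funext => i /=; rewrite -natr1; ring.
rewrite !IH -natr1; ring.
Qed.

(** Chebyshev's argument: [|f (N / n) - f u|] is small when [N / n] is near [u],
    and is otherwise dominated by a multiple of [(N / n - u)^2], whose mean
    tends to [0]. *)
Lemma bernstein_approx f e : 0 < e -> continuous_on 1 f ->
  exists n, forall u, 0 <= u <= 1 ->
    `|(bernstein n.+1 (fun i => f (i%:R / n.+1%:R))).[u] - f u| <= e.
Proof.
move=> e0 cf; have [d d0 hd] := Heine cf (divr_gt0 e0 (ltr0n _ 2)).
have [B B0 hB] : exists2 B, 0 < B & forall u, 0 <= u <= 1 -> `|f u| <= B.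
  exact: continuous_on_bounded.
(* Beyond distance d the oscillation 2 B of f is at most K (v - u)^2. *)
pose K := 2 * B / d ^+ 2.
have K0 : 0 < K by rewrite divr_gt0 ?mulr_gt0 ?exprn_gt0.
have [n hn] : exists n, K / n.+1%:R <= e / 2.
  have e2 : 0 < e / 2 by rewrite divr_gt0.
  exists (Num.truncn (K / (e / 2))); rewrite ler_pdivrMr ?ltr0n// mulrC.
  by rewrite -ler_pdivrMr// ltW// truncnS_gt.
exists n => u u01; set N := n.+1 in hn *; have N0 : 0 < N%:R :> R by rewrite ltr0n.
have dev i : (i <= N)%N -> `|f (i%:R / N%:R) - f u| <=
    e / 2 + (K / N%:R ^+ 2) * (i%:R - N%:R * u) ^+ 2.
  move=> iN; set v := i%:R / N%:R.
  have v01 : 0 <= v <= 1 by rewrite divr_ge0 ?ler0n// ler_pdivrMr// mul1r ler_nat.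
  have -> : K / N%:R ^+ 2 * (i%:R - N%:R * u) ^+ 2 = K * (v - u) ^+ 2.
    by rewrite /v; field; rewrite gt_eqF.
  have [vu|vu] := ltP `|v - u| d.
    by rewrite (le_trans (ltW (hd _ _ v01 u01 vu)))// lerDl mulr_ge0 ?sqr_ge0// ltW.
  have : K * d ^+ 2 <= K * (v - u) ^+ 2.
    by rewrite ler_pM2l// -[leRHS]real_normK ?num_real// ler_pXn2r ?nnegrE// ltW.
  rewrite /K divfK ?gt_eqF ?exprn_gt0//.
  have := ler_normB (f v) (f u); have := hB _ v01; have := hB _ u01; lra.
have var : (bernstein N (fun i => e / 2 + (K / N%:R ^+ 2) * (i%:R - N%:R * u) ^+ 2)).[u] <= e.
  rewrite bernsteinD bernstein_cst bernsteinZ bernstein_variance subrr expr0n add0r.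
  have -> : K / N%:R ^+ 2 * (N%:R * (u * (1 - u))) = K / N%:R * (u * (1 - u)).
    by field; rewrite gt_eqF.
  have : u * (1 - u) <= 1 by nra.
  have : 0 <= u * (1 - u) by nra.
  have : 0 < K / N%:R by rewrite divr_gt0.
  nra.
have -> : (bernstein N (fun i => f (i%:R / N%:R))).[u] - f u =
    (bernstein N (fun i => f (i%:R / N%:R) - f u)).[u].
  by rewrite bernsteinD bernstein_cst.
rewrite ler_norml; apply/andP; split; last first.
  apply: le_trans var; apply: bernstein_le => // i iN.
  by rewrite (le_trans (ler_norm _))// dev.
rewrite lerNl; apply: le_trans var; rewrite -mulN1r -bernsteinZ.
apply: bernstein_le => // i iN.
by rewrite mulN1r (le_trans (ler_norm _))// normrN dev.
Qed.

Theorem Weierstrass M f : 0 < M -> continuous_on M f -> unif_approx M f.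
Proof.
move=> M0 cf e e0.
have [|n hn] := @bernstein_approx (fun u => f (M * u)) e e0.
  move=> x e' /andP[x0 x1] e'0; have [|d d0 hd] := cf (M * x) e' _ e'0.
    by rewrite mulr_ge0 ?(ltW M0)// ler_piMr// ltW.
  exists (d / M) => [|y /andP[y0 y1] xy]; first exact: divr_gt0.
  apply: hd; first by rewrite mulr_ge0 ?(ltW M0)// ler_piMr// ltW.
  by rewrite -mulrBr normrM gtr0_norm// mulrC -ltr_pdivlMr.
set p := bernstein _ _ in hn; exists (p \Po (M^-1 *: 'X)) => u /andP[u0 uM].
rewrite horner_comp hornerZ hornerX.
have {2}<- : M * (M^-1 * u) = u by rewrite mulrA divff ?gt_eqF// mul1r.
apply: hn; rewrite mulr_ge0 ?invr_ge0 ?(ltW M0)//= mulrC ler_pdivrMr//.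
by rewrite mul1r.
Qed.

End Weierstrass.

(** * The continuous functional calculus *)

Lemma poly_opB {R : realType} {H : hilbertType R} (p q : {poly R}) (P : {linear H -> H}) x :
  poly_op (p - q) P x = poly_op p P x - poly_op q P x.
Proof.
have -> : p - q = p + q * (-1)%:P by rewrite polyCN mulrN mulr1.
by rewrite poly_opD poly_opMC linearZ /= rmorphN scaleN1r.
Qed.

Lemma horner_bounded {R : realType} (p : {poly R}) (M : R) : 0 <= M ->
  exists2 B, 0 <= B & forall u, 0 <= u <= M -> `|p.[u]| <= B.
Proof.
move=> M0; have [c _ hc] := horner_min (- (p * p)) M0.
exists `|p.[c]| => // u /hc; rewrite !hornerE lerN2 -!expr2 => pp.
by rewrite -(@ler_pXn2r _ 2)// ?nnegrE// !real_normK ?num_real.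
Qed.

(** Lets an error term linear in [e] vanish. *)
Lemma le_mul_small {R : realType} (a b K : R) :
  (forall e, 0 < e -> a <= b + K * e) -> a <= b.
Proof. by move=> h; apply: (@le_of_rate _ _ _ K) => n; exact: h (rate_gt0 n). Qed.

Section FunctionalCalculus.
Context {R : realType} {H : hilbertType R}.
Implicit Types (P Q : {linear H -> H}) (f g : R -> R) (p q : {poly R}) (x y : H).

(** The functional calculus on a fixed interval [[0, M]], which may be larger
    than [[0, opnorm P]]. Two different operators can then share the interval,
    as [fcalc_intertwine] requires. *)
Definition fcalc (M : R) f (P Q : H -> H) := forall e, 0 < e -> exists p,
  (forall u, 0 <= u <= M -> `|p.[u] - f u| <= e) /\
  (forall x, nrm (poly_op p P x - Q x) <= e * nrm x).

Lemma fcalc_ext M f g P (Q Q' : H -> H) : fcalc M f P Q ->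
  (forall u, 0 <= u <= M -> f u = g u) -> Q =1 Q' -> fcalc M g P Q'.
Proof.
move=> fQ fg QQ' e e0; have [p [pf pQ]] := fQ e e0; exists p.
by split=> [u uM|x]; rewrite -?fg -?QQ'; auto.
Qed.

Lemma fcalc_poly M p P : fcalc M (horner p) P (poly_op p P).
Proof.
move=> e e0; exists p; split=> [u _|x]; first by rewrite subrr normr0 ltW.
by rewrite subrr nrm0 mulr_ge0 ?nrm_ge0// ltW.
Qed.

Lemma fcalc_id M P : fcalc M id P P.
Proof.
apply: fcalc_ext (fcalc_poly M 'X P) _ _ => [u _|x]; first by rewrite hornerX.
exact: poly_opX.
Qed.

Lemma fcalc_cst M c P : fcalc M (fun=> c) P (fun x => c%:C *: x).
Proof.
apply: fcalc_ext (fcalc_poly M c%:P P) _ _ => [u _|x]; first by rewrite hornerC.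
exact: poly_opC.
Qed.

Lemma fcalcW N M f P Q : N <= M -> fcalc M f P Q -> fcalc N f P Q.
Proof.
move=> NM fQ e /fQ[p [pf pQ]]; exists p; split=> // u /andP[u0 uN].
by rewrite pf// u0 (le_trans uN).
Qed.

Lemma fcalcD M f g P (Q Q' : H -> H) : fcalc M f P Q -> fcalc M g P Q' ->
  fcalc M (fun u => f u + g u) P (fun x => Q x + Q' x).
Proof.
move=> fQ gQ e e0; have e2 : 0 < e / 2 by rewrite divr_gt0.
have [p [pf pQ]] := fQ _ e2; have [q [qg qQ]] := gQ _ e2.
exists (p + q); split=> [u uM|x].
  rewrite hornerD opprD addrACA (splitr e).
  by rewrite (le_trans (ler_normD _ _))// lerD ?pf ?qg.
rewrite poly_opD opprD addrACA (le_trans (nrm_triangle _ _))//.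
by rewrite (splitr e) mulrDl lerD.
Qed.

Section Bounds.
Variables (M : R) (P : {linear H -> H}).
Hypotheses (M0 : 0 <= M) (PM : numrange_in M P).

(** Approximating polynomials [p] of [f] and [q] of [g] differ by little more
    than [c] on [[0, M]], so [poly_op_norm_le] applies to [p - q]. Uniqueness is
    the case [f = g]. *)
Lemma fcalc_dist f g (Q Q' : H -> H) c x : 0 <= c ->
  fcalc M f P Q -> fcalc M g P Q' ->
  (forall u, 0 <= u <= M -> `|f u - g u| <= c) ->
  nrm (Q x - Q' x) <= c * nrm x.
Proof.
move=> c0 fQ gQ fg; apply: (@le_mul_small _ _ _ (4 * nrm x)) => e e0.
have [p [pf pQ]] := fQ e e0; have [q [qg qQ]] := gQ e e0.
have pq : nrm (poly_op (p - q) P x) <= (c + 2 * e) * nrm x.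
  apply: (poly_op_norm_le PM) => //; first by lra.
  move=> u uM; have := pf u uM; have := qg u uM; have := fg u uM.
  by rewrite hornerD hornerN !ler_norml; lra.
have := nrm_triangle (Q x - poly_op p P x) (poly_op p P x - Q' x).
rewrite addrA subrK (nrm_distC (Q x) (poly_op p P x)).
have := nrm_triangle (poly_op p P x - poly_op q P x) (poly_op q P x - Q' x).
rewrite addrA subrK -poly_opB.
have := pQ x; have := qQ x; lra.
Qed.

Lemma fcalc_unique f (Q Q' : H -> H) : fcalc M f P Q -> fcalc M f P Q' -> Q =1 Q'.
Proof.
move=> fQ fQ' x; apply/eqP; rewrite -subr_eq0; apply/eqP/nrm0_eq0/eqP.
rewrite eq_le nrm_ge0 andbT -(mul0r (nrm x)) (fcalc_dist _ _ fQ fQ')// => u _.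
by rewrite subrr normr0.
Qed.

Lemma fcalc_norm_le f (Q : H -> H) B x : 0 <= B -> fcalc M f P Q ->
  (forall u, 0 <= u <= M -> `|f u| <= B) -> nrm (Q x) <= B * nrm x.
Proof.
move=> B0 fQ fB; rewrite -[Q x]subr0 -(scale0r x).
by apply: (fcalc_dist _ B0 fQ (fcalc_cst M 0 P)) => u uM; rewrite subr0 fB.
Qed.

Lemma fcalc_bounded f (Q : H -> H) : fcalc M f P Q -> exists B, bound B Q.
Proof.
move=> fQ; have [p [pf pQ]] := fQ 1 ltr01; have [B B0 hB] := horner_bounded p M0.
exists (1 + B); split; first by rewrite addr_ge0.
move=> x; have := nrm_triangle (Q x - poly_op p P x) (poly_op p P x).
rewrite subrK nrm_distC => /le_trans; apply; rewrite mulrDl lerD//.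
exact: (poly_op_norm_le PM).
Qed.

(** [p q - f g = p (q - g) + (p - f) g], on functions and on operators alike. *)
Lemma fcalcM f g (Q Q' : H -> H) : fcalc M f P Q -> fcalc M g P Q' ->
  (exists2 B, 0 <= B & forall u, 0 <= u <= M -> `|f u| <= B) ->
  (exists2 B, 0 <= B & forall u, 0 <= u <= M -> `|g u| <= B) ->
  fcalc M (fun u => f u * g u) P (Q \o Q').
Proof.
move=> fQ gQ [B1 B10 fB1] [B2 B20 gB2] e e0.
pose B := B1 + B2; have B0 : 0 <= B by rewrite addr_ge0.
have fB u : 0 <= u <= M -> `|f u| <= B by move=> /fB1 /le_trans; apply; rewrite lerDl.
have gB u : 0 <= u <= M -> `|g u| <= B by move=> /gB2 /le_trans; apply; rewrite lerDr.
(* The error is at most (B + d) d + d B, and d <= 1. *)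
pose d := Num.min 1 (e / (2 * B + 1)).
have d0 : 0 < d by rewrite lt_min ltr01 divr_gt0// ltr_wpDl// mulr_ge0.
have d1 : d <= 1 by rewrite ge_min lexx.
have de : d * (2 * B + 1) <= e.
  by rewrite -ler_pdivlMr ?ge_min ?lexx ?orbT// ltr_wpDl// mulr_ge0.
have [p [pf pQ]] := fQ d d0; have [q [qg qQ]] := gQ d d0.
have pB u : 0 <= u <= M -> `|p.[u]| <= B + d.
  by move=> uM; have := pf u uM; have := fB u uM; rewrite !ler_norml; lra.
exists (p * q); split=> [u uM|x].
  have -> : (p * q).[u] - f u * g u = p.[u] * (q.[u] - g u) + (p.[u] - f u) * g u.
    by rewrite hornerM; ring.
  rewrite (le_trans (ler_normD _ _))// !normrM.
  have h1 : `|p.[u]| * `|q.[u] - g u| <= (B + d) * d.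
    by apply: ler_pM => //; [exact: pB|exact: qg].
  have h2 : `|p.[u] - f u| * `|g u| <= d * B.
    by apply: ler_pM => //; [exact: pf|exact: gB].
  have h3 : d * d <= d by rewrite ler_piMr// ltW.
  by move: de; rewrite mulrDr mulrCA; lra.
rewrite poly_opM /=.
have h1 : nrm (poly_op p P (poly_op q P x - Q' x)) <= (B + d) * (d * nrm x).
  apply: (@le_trans _ _ ((B + d) * nrm (poly_op q P x - Q' x))).
    by apply: (poly_op_norm_le PM) => //; rewrite addr_ge0// ltW.
  by rewrite ler_wpM2l// addr_ge0// ltW.
have h2 : nrm (poly_op p P (Q' x) - Q (Q' x)) <= d * (B * nrm x).
  by rewrite (le_trans (pQ _))// ler_wpM2l ?(ltW d0)// (fcalc_norm_le _ B0 gQ).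
have := nrm_triangle (poly_op p P (poly_op q P x - Q' x)) (poly_op p P (Q' x) - Q (Q' x)).
rewrite linearB addrA subrK => /le_trans; apply.
have h3 : (B + d) * d + d * B <= e.
  have h3 : d * d <= d by rewrite ler_piMr// ltW.
  by move: de; rewrite mulrDr mulrCA; lra.
have := ler_wpM2r (nrm_ge0 x) h3; rewrite linearB in h1.
by move: h1 h2; rewrite mulrDl !mulrA; lra.
Qed.

Lemma fcalc_le f g (Q Q' : H -> H) x : fcalc M f P Q -> fcalc M g P Q' ->
  (forall u, 0 <= u <= M -> f u <= g u) -> rip (Q x) x <= rip (Q' x) x.
Proof.
move=> fQ gQ fg; apply: (@le_mul_small _ _ _ (4 * nrm x ^+ 2)) => e e0.
have [p [pf pQ]] := fQ e e0; have [q [qg qQ]] := gQ e e0.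
have : 0 <= rip (poly_op ((q - p) + (2 * e)%:P) P x) x.
  apply: (poly_op_ge0 PM) => // u uM; have := pf u uM; have := qg u uM; have := fg u uM.
  by rewrite !hornerE !ler_norml; lra.
rewrite poly_opD poly_opB poly_opC !ripDl ripNl ripZl rip_nrm.
have h1 : rip (Q x - poly_op p P x) x <= e * nrm x ^+ 2.
  by rewrite (le_trans (rip_le _ _))// nrm_distC expr2 mulrA ler_wpM2r ?nrm_ge0.
have h2 : rip (poly_op q P x - Q' x) x <= e * nrm x ^+ 2.
  by rewrite (le_trans (rip_le _ _))// expr2 mulrA ler_wpM2r ?nrm_ge0.
by move: h1 h2; rewrite !ripDl !ripNl; lra.
Qed.

Lemma fcalc_self_adjoint f (Q : H -> H) : fcalc M f P Q -> adjoint_pair Q Q.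
Proof.
move=> fQ x y; apply/eqP; rewrite -subr_eq0; apply/eqP/nrm0_eq0/eqP.
rewrite eq_le nrm_ge0 andbT.
apply: (@le_mul_small _ _ _ (2 * (nrm x * nrm y))) => e e0; rewrite add0r.
have [p [_ pQ]] := fQ e e0; case: PM => sP _.
have := poly_op_self_adjoint p sP x y => sp.
have -> : hdot (Q x) y - hdot x (Q y) =
    hdot x (poly_op p P y - Q y) - hdot (poly_op p P x - Q x) y.
  rewrite linearBr linearBl /= sp; ring.
rewrite (le_trans (nrm_triangle _ _))// nrmN.
have h1 := Cauchy_Schwarz x (poly_op p P y - Q y).
have h2 := Cauchy_Schwarz (poly_op p P x - Q x) y.
have h3 := ler_wpM2l (nrm_ge0 x) (pQ y).
have h4 := ler_wpM2r (nrm_ge0 y) (pQ x).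
by rewrite mulrCA in h3; rewrite -mulrA in h4; lra.
Qed.

(** Makes the operator [f(P)] itself subject to the calculus, as needed for
    powers of an absolute value. *)
Lemma fcalc_numrange f (Q : H -> H) B : fcalc M f P Q ->
  (forall u, 0 <= u <= M -> 0 <= f u <= B) -> numrange_in B Q.
Proof.
move=> fQ fB; split; first exact: fcalc_self_adjoint fQ.
move=> x; apply/andP; split.
  have := @fcalc_le _ _ _ _ x (fcalc_cst M 0 P) fQ.
  by rewrite ripZl mul0r; apply => u /fB/andP[].
rewrite -rip_nrm -ripZl; apply: fcalc_le fQ (fcalc_cst M B P) _ => u.
by case/fB/andP.
Qed.

Lemma fcalc_exists f : unif_approx M f -> exists Q : {linear H -> H}, fcalc M f P Q.
Proof.
move=> fa; have /choice[p hp] : forall n, exists p, forall u, 0 <= u <= M ->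
    `|p.[u] - f u| <= rate n by move=> n; exact: fa (rate_gt0 n).
have cauchy x m n :
    nrm (poly_op (p m) P x - poly_op (p n) P x) <= nrm x * (rate m + rate n).
  rewrite -poly_opB mulrC; apply: (poly_op_norm_le PM) => //.
    by rewrite addr_ge0// ltW// rate_gt0.
  move=> u uM; have := hp m u uM; have := hp n u uM.
  by rewrite hornerD hornerN !ler_norml; lra.
have /choice[Q hQ] x := complete_rate (cauchy x).
have linQ : linear Q.
  move=> a x y; apply/eqP; rewrite -subr_eq0; apply/eqP/nrm0_eq0/eqP.
  rewrite eq_le nrm_ge0 andbT.
  apply: (@le_of_rate _ _ _ (nrm (a *: x + y) + nrm a * nrm x + nrm y)) => n.
  have h1 := hQ (a *: x + y) n; have h2 := hQ x n; have h3 := hQ y n.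
  rewrite linearP in h1.
  have h4 := ler_wpM2l (nrm_ge0 a) h2; rewrite -nrmZ in h4.
  set X := poly_op (p n) P x in h1 h2 h4; set Y := poly_op (p n) P y in h1 h3.
  have -> : Q (a *: x + y) - (a *: Q x + Q y) =
      - (a *: X + Y - Q (a *: x + y)) + (a *: (X - Q x) + (Y - Q y)).
    by rewrite scalerBr opprB (addrACA (a *: X)) -opprD addrA subrK.
  rewrite (le_trans (nrm_triangle _ _))// nrmN.
  have := nrm_triangle (a *: (X - Q x)) (Y - Q y); lra.
pose QL : {linear H -> H} := HB.pack Q (GRing.isLinear.Build _ _ _ _ Q linQ).
exists QL => e e0; have [N /(_ N (leqnn N))] := rate_small 1 e0.
rewrite mul1r => /ltW rN; exists (p N); split=> [u uM|x].
  by rewrite (le_trans (hp N u uM)).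
by rewrite (le_trans (hQ x N))// mulrC ler_wpM2r ?nrm_ge0.
Qed.

Lemma fcalc_is_fun_calc f Q : fcalc M f P Q -> is_fun_calc f P Q.
Proof.
move=> fQ; have /choice[p hp] n := fQ _ (rate_gt0 n); exists p; split.
  move=> e e0; have [N hN] := rate_small 1 e0; exists N => // n /= Nn u /andP[u0 uP].
  have [pf _] := hp n; rewrite (le_trans (pf u _))//; last first.
    by rewrite ltW// -[rate n]mul1r hN.
  rewrite u0 (le_trans uP)//; apply: opnorm_le; split=> // x.
  exact: (numrange_norm_le PM).
apply/cvgrPdist_lt => e e0; have [N hN] := rate_small 1 e0; exists N => // n /= Nn.
rewrite sub0r normrN ger0_norm ?opnorm_ge0//.
rewrite (le_lt_trans _ (hN n Nn))// mul1r; apply: opnorm_le.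
by split; [exact: ltW (rate_gt0 n)|case: (hp n)].
Qed.

Lemma is_fun_calc_fcalc f Q : is_fun_calc f P Q -> bounded_op Q ->
  fcalc (opnorm P) f P Q.
Proof.
move=> [p [pf pQ]] /bounded_opP[B [B0 hB]] e e0.
have [N1 _ h1] := pf e e0.
have /cvgrPdist_lt/(_ e e0)[N2 _ h2] := pQ.
pose n := maxn N1 N2; exists (p n); split; first exact: h1 (leq_maxl _ _).
move=> x; have := h2 n (leq_maxr _ _); rewrite /= sub0r normrN => /ltW h3.
have [C C0 hC] := horner_bounded (p n) M0.
have bd : bound (C + B) (fun x => poly_op (p n) P x - Q x).
  split=> [|z]; first by rewrite addr_ge0.
  rewrite (le_trans (nrm_triangle _ _))// nrmN mulrDl lerD//.
  exact: (poly_op_norm_le PM).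
have := @le_opnorm _ _ _ (poly_op (p n) P \- Q) bd x => /le_trans; apply.
by rewrite ler_wpM2r ?nrm_ge0// (le_trans (ler_norm _)).
Qed.

End Bounds.

(** The operator built by [fcalc_exists] meets the specification of [fun_calc];
    any other operator that meets it agrees with it on [[0, opnorm P]], hence
    is equal to it. *)
Theorem fun_calcP M f P : 0 <= M -> numrange_in M P -> unif_approx M f ->
  fcalc M f P (fun_calc f P).
Proof.
move=> M0 PM fa; have [Q fQ] := fcalc_exists M0 PM fa.
have /(@getPex _)[bQ' cQ'] : (exists Q : {linear H -> H}, bounded_op Q /\ is_fun_calc f P Q).
  exists Q; split; last exact: fcalc_is_fun_calc M0 PM _ _ fQ.
  by apply/bounded_opP; exact: fcalc_bounded M0 PM _ _ fQ.
have fQ' := is_fun_calc_fcalc M0 PM cQ' bQ'.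
have bP : bound M P by split=> // x; exact: (numrange_norm_le PM).
have PN : numrange_in (opnorm P) P.
  case: PM => sP pP; split=> // x; case/andP: (pP x) => -> _ /=.
  by rewrite (le_trans (rip_le _ _))// expr2 mulrA ler_wpM2r ?nrm_ge0// (le_opnorm bP).
apply: (fcalc_ext fQ) => //.
exact: (fcalc_unique (opnorm_ge0 P) PN (fcalcW (opnorm_le bP) fQ) fQ').
Qed.

(** Polynomials of intertwined operators are intertwined, and the approximating
    polynomials of [f] for [P] and for [P'] are close on [[0, M]]. *)
Lemma fcalc_intertwine M (A P P' : {linear H -> H}) f (Q Q' : H -> H) x :
  0 <= M -> numrange_in M P -> numrange_in M P' -> (exists K, bound K A) ->
  (forall y, A (P y) = P' (A y)) -> fcalc M f P Q -> fcalc M f P' Q' ->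
  A (Q x) = Q' (A x).
Proof.
move=> M0 PM PM' [K [K0 hK]] AP fQ fQ'.
apply/eqP; rewrite -subr_eq0; apply/eqP/nrm0_eq0/eqP.
rewrite eq_le nrm_ge0 andbT.
apply: (@le_mul_small _ _ _ (4 * K * nrm x)) => e e0; rewrite add0r.
have [p [pf pQ]] := fQ e e0; have [q [qf qQ]] := fQ' e e0.
have h1 : nrm (A (Q x - poly_op p P x)) <= K * (e * nrm x).
  by rewrite (le_trans (hK _))// ler_wpM2l// nrm_distC.
have h2 : nrm (poly_op (p - q) P' (A x)) <= 2 * e * (K * nrm x).
  apply: (@le_trans _ _ (2 * e * nrm (A x))); last by rewrite ler_wpM2l ?hK// mulr_ge0// ltW.
  apply: (poly_op_norm_le PM') => //; first by rewrite mulr_ge0// ltW.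
  move=> u uM; have := pf u uM; have := qf u uM.
  by rewrite hornerD hornerN !ler_norml; lra.
have h3 : nrm (poly_op q P' (A x) - Q' (A x)) <= e * (K * nrm x).
  by rewrite (le_trans (qQ _))// ler_wpM2l// ltW.
have -> : A (Q x) - Q' (A x) = A (Q x - poly_op p P x) +
    poly_op (p - q) P' (A x) + (poly_op q P' (A x) - Q' (A x)).
  by rewrite poly_opB linearB (poly_op_intertwine _ _ AP) !addrA !subrK.
have := nrm_triangle (A (Q x - poly_op p P x) + poly_op (p - q) P' (A x))
  (poly_op q P' (A x) - Q' (A x)).
have := nrm_triangle (A (Q x - poly_op p P x)) (poly_op (p - q) P' (A x)).
lra.
Qed.

End FunctionalCalculus.

(** * Powers of the absolute value *)

Section RealFunctions.
Context {R : realType}.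
Implicit Types (f : R -> R) (M s t e u : R).

Lemma continuous_on_powR M s : 0 <= s -> continuous_on M (fun u => u `^ s).
Proof.
rewrite le_eqVlt => /predU1P[<-|s0] x e /andP[x0 _] e0.
  by exists 1 => // y _ _; rewrite !powRr0 subrr normr0.
move: x0; rewrite le_eqVlt => /predU1P[<-|x0].
  exists (e `^ s^-1); first exact: powR_gt0.
  move=> y /andP[y0 _]; rewrite sub0r normrN ger0_norm// => ye.
  rewrite powR0 ?gt_eqF// sub0r normrN ger0_norm ?powR_ge0//.
  have -> : e = (e `^ s^-1) `^ s by rewrite -powRrM mulVf ?gt_eqF// powRr1// ltW.
  by apply: gt0_ltr_powR; rewrite ?nnegrE ?powR_ge0.
have /derivable1_diffP/differentiable_continuous : derivable (fun u => u `^ s) x 1.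
  by apply: derivable_powR; rewrite in_itv /= x0.
move=> /cvgrPdist_lt/(_ e e0)/nbhs_ballP[d d0 hd].
by exists d => // y _ xy; exact: hd.
Qed.

Lemma continuous_onD M f c : continuous_on M f -> continuous_on M (fun u => f u + c).
Proof.
move=> cf x e xM /(cf x _ xM)[d d0 hd]; exists d => // y yM xy.
by rewrite opprD addrACA subrr addr0 hd.
Qed.

Lemma continuous_on_inv M f c : 0 < c -> (forall u, 0 <= u <= M -> c <= f u) ->
  continuous_on M f -> continuous_on M (fun u => (f u)^-1).
Proof.
move=> c0 fc cf x e xM e0.
have [d d0 hd] := cf x (e * c ^+ 2) xM (mulr_gt0 e0 (exprn_gt0 2 c0)).
exists d => // y yM xy; have fx := fc x xM; have fy := fc y yM.
have fx0 := lt_le_trans c0 fx; have fy0 := lt_le_trans c0 fy.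
have -> : (f x)^-1 - (f y)^-1 = - (f x - f y) / (f x * f y).
  by field; rewrite !gt_eqF.
rewrite normrM normrN normfV (gtr0_norm (mulr_gt0 fx0 fy0)) ltr_pdivrMr ?mulr_gt0//.
rewrite (lt_le_trans (hd y yM xy))// ler_pM2l// expr2.
by apply: ler_pM => //; exact: ltW.
Qed.

Lemma powR_bounded M s : 0 <= s ->
  exists2 B, 0 <= B & forall u, 0 <= u <= M -> `|u `^ s| <= B.
Proof.
move=> /(continuous_on_powR (M := M))/continuous_on_bounded[B B0 hB].
by exists B => //; exact: ltW.
Qed.

(** At [u = 0] this needs the signs: [0 `^ 0 = 1] while [0 `^ s = 0] for [s > 0]. *)
Lemma powR_mulD u s t : 0 <= s -> 0 <= t -> u `^ s * u `^ t = u `^ (s + t).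
Proof.
move=> s0 t0; have [->|u0] := eqVneq u 0; last by rewrite powRD// u0 implybT.
have [->|s1] := eqVneq s 0; first by rewrite powRr0 mul1r add0r.
rewrite (powR0 s1) mul0r powR0// gt_eqF// ltr_wpDr// lt_neqAle eq_sym s1.
by [].
Qed.

End RealFunctions.

Section AbsoluteValue.
Context {R : realType} {H : hilbertType R}.
Implicit Types (A P : {linear H -> H}) (K s t : R) (x y : H).

Lemma adjointK K A : bound K A -> adjoint (adjoint A) =1 A.
Proof.
move=> bA; have [AB bB] := adjointP bA; have [BA _] := adjointP bB => x.
by apply: hdot_ext => z; rewrite /rip -BA (adjoint_pairC AB).
Qed.

Lemma numrange_adjoint_comp K A : bound K A ->
  numrange_in (K ^+ 2) (adjoint A \o A).
Proof.
move=> bA; have [AB _] := adjointP bA; have BA := adjoint_pairC AB.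
split=> [x y|x] /=; first by rewrite BA AB.
rewrite (adjoint_pair_rip _ _ BA) rip_nrm sqr_ge0 /= -exprMn.
case: bA => K0 hA.
by rewrite ler_pXn2r ?nnegrE ?mulr_ge0 ?nrm_ge0.
Qed.

Lemma op_powerP K P s : 0 < K -> numrange_in K P -> 0 <= s ->
  fcalc K (fun u => u `^ s) P (op_power P s).
Proof.
move=> K0 PK s0; apply: fun_calcP (ltW K0) PK _.
exact: Weierstrass K0 (continuous_on_powR s0).
Qed.

Lemma op_powerD K P s t x : 0 < K -> numrange_in K P -> 0 <= s -> 0 <= t ->
  op_power P s (op_power P t x) = op_power P (s + t) x.
Proof.
move=> K0 PK s0 t0; have st0 : 0 <= s + t by exact: addr_ge0.
have cst : fcalc K (fun u => u `^ (s + t)) P (op_power P s \o op_power P t).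
  have := fcalcM (ltW K0) PK (op_powerP K0 PK s0) (op_powerP K0 PK t0)
    (powR_bounded K s0) (powR_bounded K t0).
  by move=> /fcalc_ext; apply=> // u _; rewrite powR_mulD.
exact: (fcalc_unique (ltW K0) PK cst (op_powerP K0 PK st0) x).
Qed.

Lemma op_power1 K P : 0 < K -> numrange_in K P -> op_power P 1 =1 P.
Proof.
move=> K0 PK; apply: (fcalc_unique (ltW K0) PK (op_powerP K0 PK ler01)).
by apply: fcalc_ext (fcalc_id K P) _ _ => // u /andP[u0 _]; rewrite powRr1.
Qed.

Lemma op_absP K A : 0 < K -> bound K A ->
  fcalc (K ^+ 2) (fun u => u `^ 2^-1) (adjoint A \o A) (op_abs A).
Proof.
move=> K0 bA; apply: (@op_powerP _ (adjoint A \o A)); rewrite ?exprn_gt0//.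
exact: numrange_adjoint_comp.
Qed.

Lemma numrange_op_abs K A : 0 < K -> bound K A -> numrange_in K (op_abs A).
Proof.
move=> K0 bA; apply: (@fcalc_numrange _ _ _ (adjoint A \o A)) (op_absP K0 bA) _.
- exact: sqr_ge0.
- exact: numrange_adjoint_comp.
move=> u /andP[u0 uK]; rewrite powR_ge0 powR12_sqrt//=.
by rewrite -(ger0_norm (ltW K0)) -sqrtr_sqr ler_wsqrtr.
Qed.

Lemma op_abs_sqr K A x : 0 < K -> bound K A ->
  op_abs A (op_abs A x) = adjoint A (A x).
Proof.
move=> K0 bA; have nA := numrange_adjoint_comp bA.
have K20 : 0 < K ^+ 2 by rewrite exprn_gt0.
have h2 : 0 <= 2^-1 :> R by rewrite invr_ge0.
have /= e1 := @op_powerD (K ^+ 2) (adjoint A \o A) 2^-1 2^-1 x K20 nA h2 h2.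
have /= e2 := @op_power1 (K ^+ 2) (adjoint A \o A) K20 nA x.
by rewrite /op_abs e1 -[2^-1]mul1r -splitr.
Qed.

(** Both absolute values are the square root, on the same interval, of operators
    that [A] intertwines. *)
Lemma op_abs_intertwine K A x : 0 < K -> bound K A ->
  A (op_abs A x) = op_abs (adjoint A) (A x).
Proof.
move=> K0 bA; have [_ bB] := adjointP bA.
apply: (@fcalc_intertwine _ _ (K ^+ 2) A (adjoint A \o A)
  (adjoint (adjoint A) \o adjoint A)) (op_absP K0 bA) (op_absP K0 bB).
- exact: sqr_ge0.
- exact: numrange_adjoint_comp.
- exact: numrange_adjoint_comp.
- by exists K.
- by move=> y /=; rewrite (adjointK bA).
Qed.

(** The regularisation by [e] makes [f u = u^(2t) + e] invertible; with
    [g = 1 / f] the inverse of [F + e] is [g(|A|)], called [GA] below, and [GB]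
    is its counterpart for the adjoint. *)
Theorem mixed_Schwarz K A t x y : 0 < K -> bound K A -> 0 <= t <= 1 ->
  nrm (hdot (A x) y) ^+ 2 <= rip (op_power (op_abs A) (2 * t) x) x *
    rip (op_power (op_abs (adjoint A)) (2 * (1 - t)) y) y.
Proof.
move=> K0 bA /andP[t0 t1]; have [AB bB] := adjointP bA.
have t20 : 0 <= 2 * t by rewrite mulr_ge0.
have t21 : 0 <= 2 * (1 - t) by rewrite mulr_ge0// subr_ge0.
have K0' := ltW K0.
set F := op_power (op_abs A) (2 * t); set G := op_power _ (2 * (1 - t)).
have PA := numrange_op_abs K0 bA; have PB := numrange_op_abs K0 bB.
have cF := op_powerP K0 PA t20; have cG := op_powerP K0 PB t21.
apply: (@le_mul_small _ _ _ (nrm x ^+ 2 * rip (G y) y)) => e e0.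
pose f u : R := u `^ (2 * t) + e; pose g u := (f u)^-1.
have fe u : e <= f u by rewrite lerDr powR_ge0.
have f0 u : 0 < f u by rewrite (lt_le_trans e0).
have cf : continuous_on K f by apply: continuous_onD; exact: continuous_on_powR.
have cg : continuous_on K g by apply: (continuous_on_inv e0) => // u _; exact: fe.
have [Fe cFe] := fcalc_exists K0' PA (Weierstrass K0 cf).
have [GA cGA] := fcalc_exists K0' PA (Weierstrass K0 cg).
have [GB cGB] := fcalc_exists K0' PB (Weierstrass K0 cg).
have bf : exists2 B, 0 <= B & forall u, 0 <= u <= K -> `|f u| <= B.
  by have [B /ltW ? ?] := continuous_on_bounded cf; exists B.
have bg : exists2 B, 0 <= B & forall u, 0 <= u <= K -> `|g u| <= B.
  by have [B /ltW ? ?] := continuous_on_bounded cg; exists B.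
have bi : exists2 B, 0 <= B & forall u, 0 <= u <= K -> `|id u| <= B.
  by exists K => // u /andP[u0 uK]; rewrite ger0_norm.
have FeE z : Fe z = F z + e%:C *: z.
  exact: (fcalc_unique K0' PA cFe (fcalcD cF (fcalc_cst K e _))).
have FeK z : Fe (GA z) = z.
  have c1 : fcalc K (fun u => f u * g u) (op_abs A) id.
    apply: fcalc_ext (fcalc_cst K 1 (op_abs A)) _ _ => [u _|w]; last by rewrite scale1r.
    by rewrite divff// gt_eqF.
  exact: (fcalc_unique K0' PA (fcalcM K0' PA cFe cGA bf bg) c1).
have AGA z : A (GA z) = GB (A z).
  apply: (fcalc_intertwine z K0' PA PB _ _ cGA cGB) => [|w]; first by exists K.
  exact: op_abs_intertwine K0 bA.
have posFe : positive_op Fe.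
  have [B B0 hB] := bf; have [|sFe pFe] := @fcalc_numrange _ _ _ _ K0' PA f Fe B cFe.
    by move=> u uK; rewrite (ltW (f0 u))/= (le_trans (ler_norm _))// hB.
  by split=> // z; case/andP: (pFe z).
pose z := GA (adjoint A y).
have -> : hdot (A x) y = hdot (Fe x) z by rewrite AB -(FeK (adjoint A y)) posFe.1.
apply: (le_trans (Cauchy_Schwarz_form _ _ posFe)).
have -> : rip (Fe x) x = rip (F x) x + e * nrm x ^+ 2.
  by rewrite FeE ripDl ripZl rip_nrm.
suff h : rip (Fe z) z <= rip (G y) y.
  apply: (le_trans (ler_wpM2l _ h)); last by rewrite mulrDl; lra.
  rewrite -rip_nrm -ripZl -ripDl -FeE; exact: posFe.2.
have -> : rip (Fe z) z = rip (GB (op_abs (adjoint A) (op_abs (adjoint A) y))) y.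
  rewrite FeK (adjoint_pair_rip _ _ (adjoint_pairC AB)) AGA ripC.
  by rewrite (op_abs_sqr _ K0 bB) (adjointK bA).
have ci := fcalc_id K (op_abs (adjoint A)).
have bii : exists2 B, 0 <= B & forall u, 0 <= u <= K -> `|u * u| <= B.
  exists (K * K) => [|u /andP[u0 uK]]; first by rewrite mulr_ge0.
  by rewrite ger0_norm ?mulr_ge0// ler_pM.
apply: (@fcalc_le _ _ _ _ K0' PB (fun u => g u * (u * u)) _
  (GB \o (op_abs (adjoint A) \o op_abs (adjoint A))) _ y _ cG).
  exact: (fcalcM K0' PB cGB (fcalcM K0' PB ci ci bi bi) bg bii).
move=> u /andP[u0 _]; rewrite mulrC ler_pdivrMr//.
rewrite mulrDr powR_mulD// -mulrDr subrK mulr1.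
by rewrite powR_mulrn// expr2 lerDl mulr_ge0 ?powR_ge0// ltW.
Qed.

End AbsoluteValue.

(** * Euclidean operator radius *)

(** The variance of the [c k] is nonnegative. *)
Lemma sum_Cauchy_Schwarz {R : rcfType} d (c : 'I_d -> R) :
  \sum_k c k <= Num.sqrt d%:R * Num.sqrt (\sum_k c k ^+ 2).
Proof.
set S := \sum_k c k; set Q := \sum_k c k ^+ 2.
rewrite -sqrtrM ?ler0n//; case: d c @S @Q => [|d] c S Q.
  by rewrite /S big_ord0 sqrtr_ge0.
have D0 : 0 < d.+1%:R :> R by rewrite ltr0n.
suff SQ : S ^+ 2 <= d.+1%:R * Q.
  by rewrite (le_trans (ler_norm S))// -sqrtr_sqr ler_wsqrtr.
rewrite -subr_ge0 -(pmulr_rge0 _ D0).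
have -> : d.+1%:R * (d.+1%:R * Q - S ^+ 2) = \sum_k (d.+1%:R * c k - S) ^+ 2.
  have E k : (d.+1%:R * c k - S) ^+ 2 =
    d.+1%:R ^+ 2 * c k ^+ 2 + (- 2 * d.+1%:R * S) * c k + S ^+ 2 by ring.
  under eq_bigr do rewrite E.
  rewrite !big_split /= -!mulr_sumr sumr_const card_ord -mulr_natl -/S -/Q; ring.
by apply: sumr_ge0 => k _; exact: sqr_ge0.
Qed.

Lemma rip_suml {R : realType} {H : hilbertType R} (I : Type) (r : seq I)
  (F : I -> H) (y : H) : rip (\sum_(i <- r) F i) y = \sum_(i <- r) rip (F i) y.
Proof.
elim: r => [|i r IH]; last by rewrite !big_cons ripDl IH.
by rewrite !big_nil -(scale0r y) (ripZl 0) mul0r.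
Qed.

Lemma boundD {R : realType} {H : hilbertType R} M N (T S : H -> H) :
  bound M T -> bound N S -> bound (M + N) (fun x => T x + S x).
Proof.
move=> [M0 hM] [N0 hN]; split=> [|x]; first exact: addr_ge0.
by rewrite (le_trans (nrm_triangle _ _))// mulrDl lerD.
Qed.

Lemma bound_sum {R : realType} {H : hilbertType R} (I : Type) (r : seq I)
    (M : I -> R) (T : I -> H -> H) : (forall i, bound (M i) (T i)) ->
  bound (\sum_(i <- r) M i) (fun x => \sum_(i <- r) T i x).
Proof.
move=> bT; split=> [|x]; first by apply: sumr_ge0 => i _; case: (bT i).
elim: r => [|i r IH]; first by rewrite !big_nil nrm0 mul0r.
rewrite !big_cons (le_trans (nrm_triangle _ _))// mulrDl lerD//.
by case: (bT i).
Qed.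

Section EuclideanRadius.
Context {R : realType} {H : hilbertType R} {d : nat}.
Implicit Types (T : 'I_d -> H -> H) (x : H).

Lemma opnorm_ge_unit M (T : H -> H) x : bound M T -> nrm x = 1 -> nrm (T x) <= opnorm T.
Proof.
move=> [M0 hM] x1; apply: ub_le_sup; last by exists x => //=; rewrite nrmE x1.
exists M => _ /= [y y1 <-]; rewrite (le_trans (hM y))// ler_piMr//.
by move: y1; rewrite (nrmE y) (lecR _ 1).
Qed.

Lemma euclidean_radius_ge T x : (forall k, exists M, bound M (T k)) -> nrm x = 1 ->
  Num.sqrt (\sum_k nrm (hdot (T k x) x) ^+ 2) <= euclidean_radius T.
Proof.
move=> /choice[M hM] x1; apply: ub_le_sup; last by exists x => //=; rewrite nrmE x1.
exists (Num.sqrt (\sum_k M k ^+ 2)) => _ [y y1 <-].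
have {}y1 : nrm y = 1 by rewrite y1.
apply: ler_wsqrtr; apply: ler_sum => k _; have [Mk0 hk] := hM k.
rewrite ler_pXn2r ?nnegrE ?nrm_ge0//.
have := hk y; have := Cauchy_Schwarz (T k y) y; rewrite y1 !mulr1.
exact: le_trans.
Qed.

(** If there is no unit vector the supremum is that of the empty set, which is
    [0]. *)
Lemma euclidean_radius_le T r : 0 <= r ->
  (forall x, nrm x = 1 -> \sum_k nrm (hdot (T k x) x) ^+ 2 <= r) ->
  euclidean_radius T <= Num.sqrt r.
Proof.
move=> r0 h; rewrite /euclidean_radius; set E := (X in sup X).
have [[v Ev]|E0] := pselect (E !=set0)%classic.
  apply: ge_sup; first by exists v.
  by move=> _ [x x1 <-]; apply/ler_wsqrtr/h; rewrite x1.
by rewrite sup_out ?sqrtr_ge0// => -[].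
Qed.

Lemma euclidean_radius_ge0 T : 0 <= euclidean_radius T.
Proof.
rewrite /euclidean_radius; set E := (X in sup X).
have [[[v Ev] hE]|hE] := pselect (has_sup E); last by rewrite sup_out.
apply: le_trans (ub_le_sup hE Ev).
by case: Ev => x _ <-; exact: sqrtr_ge0.
Qed.

End EuclideanRadius.

Section MainEstimate.
Context {R : realType} {H : hilbertType R}.
Implicit Types (A : {linear H -> H}) (t : R) (x : H).

(** Stated for arbitrary self-adjoint [F] and [G]; they are to be the two powers
    in the mixed Schwarz inequality. *)
Lemma Buzano_product (F G : H -> H) c x :
  adjoint_pair F F -> adjoint_pair G G -> 0 <= rip (F x) x -> nrm x = 1 ->
  c <= rip (F x) x * rip (G x) x ->
  c <= 4^-1 * rip (G (G x) + F (F x)) x + 2^-1 * nrm (hdot (F (G x)) x).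
Proof.
move=> sF sG pF x1 h1.
rewrite ripDl (adjoint_pair_rip _ _ sF) (adjoint_pair_rip _ _ sG) !rip_nrm.
have -> : nrm (hdot (F (G x)) x) = nrm (hdot (F x) (G x)).
  by rewrite sF hdotC nrm_conj.
have h2 := Buzano (F x) (G x) x1.
have hF : rip (F x) x <= nrm (hdot (F x) x) by exact: Re_le_nrm.
have hG : rip (G x) x <= nrm (hdot x (G x)) by rewrite ripC; exact: Re_le_nrm.
have h3 : rip (F x) x * rip (G x) x <= nrm (hdot (F x) x) * nrm (hdot x (G x)).
  apply: (le_trans (ler_wpM2l pF hG)); apply: ler_wpM2r hF; exact: nrm_ge0.
have h4 := sqr_ge0 (nrm (F x) - nrm (G x)); rewrite sqrrB in h4.
lra.
Qed.

Lemma Buzano_mixed_Schwarz K A t x : 0 < K -> bound K A -> 0 <= t <= 1 -> nrm x = 1 ->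
  nrm (hdot (A x) x) ^+ 2 <=
  4^-1 * rip (op_power (op_abs (adjoint A)) (4 * (1 - t)) x
              + op_power (op_abs A) (4 * t) x) x
  + 2^-1 * nrm (hdot (op_power (op_abs A) (2 * t)
      (op_power (op_abs (adjoint A)) (2 * (1 - t)) x)) x).
Proof.
move=> K0 bA t01 x1; have [_ bB] := adjointP bA; have /andP[t0 t1] := t01.
have t20 : 0 <= 2 * t by rewrite mulr_ge0.
have t21 : 0 <= 2 * (1 - t) by rewrite mulr_ge0// subr_ge0.
have PA := numrange_op_abs K0 bA; have PB := numrange_op_abs K0 bB.
have -> : 4 * t = 2 * t + 2 * t by ring.
have -> : 4 * (1 - t) = 2 * (1 - t) + 2 * (1 - t) by ring.
have [B _ hB] := powR_bounded K t20.
rewrite -(f_equal2 +%R (op_powerD x K0 PB t21 t21) (op_powerD x K0 PA t20 t20)).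
apply: Buzano_product x1 (mixed_Schwarz x x K0 bA t01).
- exact: (fcalc_self_adjoint PA (op_powerP K0 PA t20)).
- exact: (fcalc_self_adjoint PB (op_powerP K0 PB t21)).
have [|_ /(_ x)/andP[]//] := fcalc_numrange (B := B) (ltW K0) PA (op_powerP K0 PA t20).
by move=> u uK; rewrite powR_ge0 (le_trans (ler_norm _))// hB.
Qed.

End MainEstimate.

Local Close Scope complex_scope.
Unset Implicit Arguments.
Set Strict Implicit.

Theorem corollary2p9 (R : realType) (H : hilbertType R) (d : nat)
    (A : 'I_d -> {linear H -> H}) :
  (1 <= d)%N ->
  (forall k : 'I_d, bounded_op (A k)) ->
  (forall t : R, 0 <= t <= 1 ->
    euclidean_radius (fun k => A k) <=
    Num.sqrt (4^-1 * opnorm (fun x : H => \sum_(k < d)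
                  (op_power (op_abs (adjoint (A k))) (4 * (1 - t)) x
                   + op_power (op_abs (A k)) (4 * t) x))
              + Num.sqrt d%:R / 2 *
                euclidean_radius (fun k =>
                  op_power (op_abs (A k)) (2 * t)
                  \o op_power (op_abs (adjoint (A k))) (2 * (1 - t)))))
  /\
  euclidean_radius (fun k => A k) <=
  Num.sqrt (4^-1 * opnorm (fun x : H => \sum_(k < d)
                (op_power (op_abs (adjoint (A k))) 2 x
                 + op_power (op_abs (A k)) 2 x))
            + Num.sqrt d%:R / 2 *
              euclidean_radius (fun k =>
                op_abs (A k) \o op_abs (adjoint (A k)))).
Proof.
move=> _ bA.
(* A positive constant, so that the functional calculus gets a nondegenerate
   interval. *)
have /choice[K hK] k : exists K, 0 < K /\ bound K (A k).
  have [K [K0 hK]] := (bounded_opP (A k)).1 (bA k); exists (1 + K).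
  rewrite ltr_wpDr//; split=> //; split=> [|x]; first by rewrite addr_ge0.
  by rewrite (le_trans (hK x))// ler_wpM2r ?nrm_ge0// lerDr.
have K0 k : 0 < K k by case: (hK k).
have bK k : bound (K k) (A k) by case: (hK k).
have bK' k : bound (K k) (adjoint (A k)) := (adjointP (bK k)).2.
have PA k := numrange_op_abs (K0 k) (bK k).
have PB k := numrange_op_abs (K0 k) (bK' k).
have bp k s (P : {linear H -> H}) : numrange_in (K k) P -> 0 <= s ->
    exists B, bound B (op_power P s).
  move=> PK s0; exact: fcalc_bounded (ltW (K0 k)) PK _ _ (op_powerP (K0 k) PK s0).
have and_dep (P Q : Prop) : P -> (P -> Q) -> P /\ Q by move=> p pq; split; auto.
apply: and_dep => [t t01|main].
  have /andP[t0 t1] := t01; have t1' : 0 <= 1 - t by rewrite subr_ge0.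
  apply: euclidean_radius_le => [|x x1].
    by rewrite addr_ge0 ?mulr_ge0 ?opnorm_ge0 ?euclidean_radius_ge0 ?sqrtr_ge0.
  apply: le_trans; first apply: ler_sum => k _.
    exact: Buzano_mixed_Schwarz (K0 k) (bK k) t01 x1.
  rewrite big_split /= -!mulr_sumr; apply: lerD.
    rewrite ler_wpM2l ?invr_ge0// -rip_suml.
    apply: le_trans (rip_le _ _) _; rewrite x1 mulr1.
    have /choice[B hB] k : exists B, bound B (fun x =>
        op_power (op_abs (adjoint (A k))) (4 * (1 - t)) x
        + op_power (op_abs (A k)) (4 * t) x).
      have [B1 b1] := bp k _ _ (PB k) (mulr_ge0 (ler0n R 4) t1').
      have [B2 b2] := bp k _ _ (PA k) (mulr_ge0 (ler0n R 4) t0).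
      by exists (B1 + B2); exact: boundD b1 b2.
    exact: opnorm_ge_unit (bound_sum _ hB) x1.
  rewrite mulrAC mulrC ler_wpM2r ?invr_ge0//.
  apply: le_trans (sum_Cauchy_Schwarz _) _; rewrite ler_wpM2l ?sqrtr_ge0//.
  apply: euclidean_radius_ge x1 => k.
  have [B1 b1] := bp k _ _ (PB k) (mulr_ge0 (ler0n R 2) t1').
  have [B2 b2] := bp k _ _ (PA k) (mulr_ge0 (ler0n R 2) t0).
  by exists (B2 * B1); exact: bound_comp b2 b1.
have := main 2^-1; rewrite invr_ge0 ler0n invf_le1// ler1n => /(_ isT).
have -> : 4 * (1 - 2^-1) = 2 :> R by field.
have -> : 4 * 2^-1 = 2 :> R by field.
have -> : 2 * (1 - 2^-1) = 1 :> R by field.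
have -> : 2 * 2^-1 = 1 :> R by field.
suff -> : (fun k => op_power (op_abs (A k)) 1 \o op_power (op_abs (adjoint (A k))) 1) =
    (fun k => op_abs (A k) \o op_abs (adjoint (A k))) :> ('I_d -> H -> H) by [].
apply/funext => k; apply/funext => x /=.
by rewrite (op_power1 (K0 k) (PA k)) (op_power1 (K0 k) (PB k)).
Qed.
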